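(* Let $f$ be a loss such that for every $z\in\mathcal{Z}$ the map $\mathbf{w}\mapsto f(\mathbf{w};z)$ is convex and $G$-Lipschitz on $\mathcal{W}$. Let $\beta\in(0,1)$, $\epsilon>0$, $\delta\in(0,1)$, and let $\sigma^2=\frac{14G^2T}{\beta n^2\epsilon}\big(\frac{\log(1/\delta)}{(1-\beta)\epsilon}+1\big)$ be the noise variance used by Algorithm 1 (described in the context) run for $T$ iterations on a dataset of size $n$. Set $\lambda=\frac{\log(1/\delta)}{(1-\beta)\epsilon}+1$. If $\sigma^2\ge 2.68G^2$ and $$\lambda-1\le \frac{\sigma^2}{6G^2}\log\Big(\frac{n}{\lambda\big(1+\frac{\sigma^2}{4G^2}\big)}\Big),$$ then Algorithm 1 satisfies $(\epsilon,\delta)$-differential privacy.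
   Context: Data space $\mathcal{Z}=\mathcal{X}\times\mathcal{Y}$ with $\mathcal{X}\subset\mathbb{R}^d$, $\mathcal{Y}\subset\mathbb{R}$. $\mathcal{W}\subseteq\mathbb{R}^d$ is a convex set and $f:\mathcal{W}\times\mathcal{Z}\to\mathbb{R}$ a loss; $\partial f(\mathbf{w};z)$ denotes a (sub)gradient in $\mathbf{w}$. $f$ is $G$-Lipschitz if $|f(\mathbf{w};z)-f(\mathbf{w}';z)|\le G\|\mathbf{w}-\mathbf{w}'\|_2$ for all $\mathbf{w},\mathbf{w}'$. Algorithm 1 (DP-SGD for pointwise learning): input a dataset $S=\{z_1,\dots,z_n\}\subset\mathcal{Z}$, step sizes $\{\eta_t\}$, privacy parameters $\epsilon,\delta$, constant $\beta\in(0,1)$, Lipschitz parameter $G$, number of iterations $T$. Set $\mathbf{w}_1=\mathbf{0}$. For $t=1,\dots,T$: sample $i_t$ uniformly from $[n]=\{1,\dots,n\}$, draw $\mathbf{b}_t\sim\mathcal{N}(0,\sigma^2\mathbf{I}_d)$ with $\sigma^2=\frac{14G^2T}{\beta n^2\epsilon}\big(\frac{\log(1/\delta)}{(1-\beta)\epsilon}+1\big)$ (all random choices independent), and set $\mathbf{w}_{t+1}=\mathrm{Proj}_{\mathcal{W}}\big(\mathbf{w}_t-\eta_t(\partial f(\mathbf{w}_t;z_{i_t})+\mathbf{b}_t)\big)$, where $\mathrm{Proj}_{\mathcal{W}}$ is Euclidean projection onto $\mathcal{W}$. Output $\mathbf{w}_{\mathrm{priv}}=\frac1T\sum_{t=1}^T\mathbf{w}_t$.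 A randomized algorithm $\mathcal{A}$ is $(\epsilon,\delta)$-differentially private if for any two datasets $S,S'$ of size $n$ differing in exactly one data point and any measurable event $E$ of the output space, $\mathbb{P}(\mathcal{A}(S)\in E)\le e^{\epsilon}\mathbb{P}(\mathcal{A}(S')\in E)+\delta$.
   Formalization: The subgradients used by Algorithm 1 are assumed to have norm at most G at every w (Lipschitzness on W does not bound them at boundary points, where the claim can fail) and to be Borel measurable in w. *)

(* Defs.v *)
From HB Require Import structures.
From mathcomp Require Import all_boot all_order all_algebra.
From mathcomp Require Import all_classical all_reals all_analysis.
Set Implicit Arguments. Unset Strict Implicit. Unset Printing Implicit Defensive.
Import Order.TTheory GRing.Theory Num.Theory.
Local Open Scope classical_set_scope.
Local Open Scope ring_scope.

Section dp_sgd.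
Variable R : realType.

Definition dotv d (u v : 'rV[R]_d) : R := \sum_(j < d) u 0 j * v 0 j.
Definition norm2 d (u : 'rV[R]_d) : R := Num.sqrt (dotv u u).

(** Conversions with d.-tuple R, which carries the product (= Borel)
    sigma-algebra of R^d in MathComp-Analysis. *)
Definition row_of_tuple d (t : d.-tuple R) : 'rV[R]_d := \row_(j < d) tnth t j.
Definition tuple_of_row d (v : 'rV[R]_d) : d.-tuple R := [tuple v 0 j | j < d].

Definition dp_convex_set d (W : set 'rV[R]_d) : Prop :=
  forall u v a, W u -> W v -> 0 <= a <= 1 -> W (a *: u + (1 - a) *: v).

Definition dp_convex_fun d (W : set 'rV[R]_d) (h : 'rV[R]_d -> R) : Prop :=
  forall u v a, W u -> W v -> 0 <= a <= 1 ->
    h (a *: u + (1 - a) *: v) <= a * h u + (1 - a) * h v.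

Definition dp_lipschitz d (W : set 'rV[R]_d) (G : R) (h : 'rV[R]_d -> R) : Prop :=
  forall u v, W u -> W v -> `|h u - h v| <= G * norm2 (u - v).

Definition is_projection d (W : set 'rV[R]_d) (p : 'rV[R]_d -> 'rV[R]_d) : Prop :=
  forall x, W (p x) /\ (forall y, W y -> norm2 (x - p x) <= norm2 (x - y)).

Definition is_subgradient {Z : Type} d (W : set 'rV[R]_d)
    (f : 'rV[R]_d -> Z -> R) (g : 'rV[R]_d -> Z -> 'rV[R]_d) : Prop :=
  forall z w, W w -> forall w', W w' -> f w z + dotv (g w z) (w' - w) <= f w' z.

(** Iterates of Algorithm 1: given the current iterate [w], the current
    (0-based) time [t], and the remaining list of (sampled data point,
    noise vector) pairs, returns the list of iterates w_1, ..., w_T. *)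
Fixpoint dpsgd_traj {Z : Type} d (proj : 'rV[R]_d -> 'rV[R]_d)
    (g : 'rV[R]_d -> Z -> 'rV[R]_d) (eta : nat -> R)
    (w : 'rV[R]_d) (t : nat) (steps : seq (Z * 'rV[R]_d)) : seq 'rV[R]_d :=
  match steps with
  | [::] => [::]
  | (z, b) :: s => w :: dpsgd_traj proj g eta (proj (w - eta t *: (g w z + b))) t.+1 s
  end.

Definition noise_of d (T : nat) (v : nat -> R) : seq 'rV[R]_d :=
  [seq \row_(j < d) v (t * d + j)%N | t <- iota 0 T].

Definition dpsgd_output {Z : Type} d n T (proj : 'rV[R]_d -> 'rV[R]_d)
    (g : 'rV[R]_d -> Z -> 'rV[R]_d) (eta : nat -> R) (S : 'I_n -> Z)
    (idx : T.-tuple 'I_n) (v : nat -> R) : 'rV[R]_d :=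
  T%:R^-1 *: \sum_(w <- dpsgd_traj proj g eta 0 0
                      (zip [seq S i | i <- idx] (noise_of d T v))) w.

(** Expectation of [F] with respect to i.i.d. N(0, s^2) coordinates
    v 0, ..., v (k-1) (iterated integral = integral against the product
    Gaussian measure); N(0,0) is the point mass at 0. *)
Fixpoint gauss_expect (s : R) (k : nat) (F : (nat -> R) -> \bar R) : \bar R :=
  match k with
  | 0 => F (fun _ => 0)
  | k'.+1 =>
      let F' x := gauss_expect s k' (fun v => F (fun i => if i == 0%N then x else v i.-1)) in
      if s == 0 then F' 0 else (\int[normal_prob 0 s]_x F' x)%E
  end.

(** P(A(S) \in E) for Algorithm 1: i_1..i_T uniform on [n] and
    b_1..b_T ~ N(0, sigma2 I_d), all independent. *)
Definition dpsgd_prob {Z : Type} d n T (proj : 'rV[R]_d -> 'rV[R]_d)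
    (g : 'rV[R]_d -> Z -> 'rV[R]_d) (eta : nat -> R) (sigma2 : R)
    (S : 'I_n -> Z) (E : set (d.-tuple R)) : \bar R :=
  (((n ^ T)%:R)^-1%:E *
   \sum_(idx : T.-tuple 'I_n)
      gauss_expect (Num.sqrt sigma2) (T * d)
        (fun v => (\1_E (tuple_of_row (dpsgd_output proj g eta S idx v)))%:E))%E.

Definition neighbouring {Z : Type} n (S S' : 'I_n -> Z) : Prop :=
  exists i, S i <> S' i /\ forall j, j != i -> S j = S' j.

Definition dpsgd_sigma2 (G eps delta beta : R) (n T : nat) : R :=
  14 * G ^+ 2 * T%:R / (beta * (n%:R) ^+ 2 * eps)
  * (ln (1 / delta) / ((1 - beta) * eps) + 1).

End dp_sgd.

(* Main.v *)
(** Relative to N(0, sigma^2 I), the law of a noisy gradient at a given iterate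
    has density m = (1/n) sum_i e_{g_i}, a uniform mixture of Gaussian densities
    e_v; changing one data point moves a single component by at most 2G.
    Writing r = m/m', a second-order expansion bounds E_{m'} r^lambda by
    1 + (lambda (lambda - 1) / 2) (a chi-square term + a tail term). Jensen's
    inequality replaces the mixture in the denominators by its components, so
    both terms become explicit Gaussian moments. With x = 4 G^2 / sigma^2 and
    p = 1/n, the hypotheses sigma^2 >= 2.68 G^2 and the bound on lambda - 1 turn
    this into E_{m'} r^lambda <= exp (3.5 lambda (lambda - 1) p^2 x).

    Composition over the T steps is an induction carrying the accumulated
    likelihood ratio; it starts from the pointwise inequality
    L <= e^eps + e^(- eps (lambda - 1)) L^lambda, and the final constants add up
    to delta because 3.5 lambda p^2 x T = beta eps. *)
Require Import Defs.
From HB Require Import structures.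
From mathcomp Require Import all_boot all_order all_algebra.
From mathcomp Require Import all_classical all_reals all_analysis.
From mathcomp Require Import measurable_realfun ring lra.
Set Implicit Arguments. Unset Strict Implicit. Unset Printing Implicit Defensive.
Import Order.TTheory GRing.Theory Num.Theory.
Local Open Scope classical_set_scope.
Local Open Scope ring_scope.

(** * Gaussian expectations *)

Section normal_shift.
Variable R : realType.
Local Notation mu := (@lebesgue_measure R).

Lemma lebesgue_measure_translation (a : R) (A : set R) : measurable A ->
  pushforward mu (fun x : measurableTypeR R => a + x : measurableTypeR R) A
    = mu A.
Proof.
have ma : measurable_fun setT
    (fun x : measurableTypeR R => a + x : measurableTypeR R).
  exact: measurable_funD.
pose mm := isMeasurableFun.Build _ _ _ _ _ ma.
pose F : {mfun _ >-> _} := HB.pack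
  (fun x : measurableTypeR R => a + x : measurableTypeR R) mm.
move=> mA; apply/esym.
apply: (@lebesgue_measure_unique _ (pushforward mu F)) => //= _ [[l r]] _ <-.
rewrite /pushforward /=.
rewrite (_ : _ @^-1` _ = `]l - a, r - a]%classic); last first.
  by apply/seteqP; split=> x /=; rewrite !in_itv/=; lra.
rewrite !lebesgue_measure_itv/= !lte_fin ltrD2r.
by case: ifP => // _; congr (_%:E); lra.
Qed.

Lemma integral_normal_probE (m s : R) (f : R -> \bar R) :
  (forall x, 0 <= f x)%E -> measurable_fun setT f ->
  (\int[normal_prob m s]_x f x = \int[mu]_x (f x * (normal_pdf m s x)%:E))%E.
Proof.
move=> f0 mf.
have dom := @normal_prob_dominates R m s.
rewrite -(Radon_Nikodym_SigmaFinite.change_of_variables dom)//.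
have gi := Radon_Nikodym_SigmaFinite.f_integrable dom.
have mg := measurable_int _ gi.
have mp : measurable_fun [set: R] (fun x => (normal_pdf m s x)%:E).
  by apply/measurable_EFinP; exact: measurable_normal_pdf.
apply: ge0_ae_eq_integral => //.
- by apply: emeasurable_funM => //.
- by apply: emeasurable_funM => //.
- by move=> x _; rewrite mule_ge0// Radon_Nikodym_SigmaFinite.f_ge0.
- by move=> x _; rewrite mule_ge0// lee_fin normal_pdf_ge0.
(* The Radon-Nikodym derivative and the explicit pdf have the same integral over every measurable
   set, so they agree almost everywhere. *)
- apply: ae_eqe_mul2l.
  apply: integral_ae_eq => //= E _ mE.
  by rewrite -Radon_Nikodym_SigmaFinite.f_integral.
Qed.

(** One-dimensional Cameron-Martin formula: translation invariance of Lebesgue measure moves the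
    shift onto the pdf, and the exponential is the ratio of the N(a, s^2) and N(0, s^2)
    densities. *)
Lemma normal_prob_shift (s a : R) (H : R -> \bar R) : s != 0 ->
  (forall x, 0 <= H x)%E -> measurable_fun setT H ->
  (\int[normal_prob 0 s]_x H (a + x)%R =
   \int[normal_prob 0 s]_x
      ((expR (a * x / s ^+ 2 - a ^+ 2 / (2 * s ^+ 2)))%:E * H x))%E.
Proof.
move=> s0 H0 mH.
have ma : measurable_fun setT
    (fun x : measurableTypeR R => a + x : measurableTypeR R).
  exact: measurable_funD.
have me : measurable_fun [set: R]
    (fun x => (expR (a * x / s ^+ 2 - a ^+ 2 / (2 * s ^+ 2)))%:E).
  apply/measurable_EFinP; apply: measurableT_comp => //.
  apply: measurable_funB => //; apply: measurable_funM => //.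
rewrite integral_normal_probE//; last exact: (measurableT_comp mH ma).
rewrite integral_normal_probE; last 2 first.
  by move=> x; rewrite mule_ge0// lee_fin expR_ge0.
  exact: emeasurable_funM.
pose K y := (H y * (normal_pdf 0 s (y - a))%:E)%E.
have mK : measurable_fun setT K.
  apply: emeasurable_funM => //; apply/measurable_EFinP.
  apply: (measurableT_comp (measurable_normal_pdf _ _)).
  exact: measurable_funB.
transitivity (\int[mu]_x K (a + x)%R)%E.
  by apply: eq_integral => x _; rewrite /K addrAC subrr add0r.
have := @ge0_integral_pushforward _ _ _ _ R _ ma mu setT K measurableT mK.
rewrite preimage_setT => /(_ _) <-; last first.
  by move=> y _; rewrite mule_ge0// lee_fin normal_pdf_ge0.
rewrite (eq_measure_integral mu); last first.
  by move=> A mA _; exact: lebesgue_measure_translation.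
apply: eq_integral => x _.
rewrite /K [RHS]muleAC [RHS]muleC; congr (_ * _)%E.
rewrite -EFinM; congr (_%:E).
rewrite !normal_pdfE// /= /normal_fun mulrCA; congr (_ * _).
rewrite -expRD; congr expR.
by field.
Qed.
End normal_shift.

Section gauss_expect_theory.
Variable R : realType.
Implicit Types (s : R) (k : nat) (v : nat -> R).

(* Quantifying over all measurable ways of producing the parameter and the
   noise avoids fixing a sigma-algebra on [nat -> R]. *)
Definition noise_measurable d (X : measurableType d)
    (F : X -> (nat -> R) -> \bar R) : Prop :=
  forall d' (Y : measurableType d') (phi : Y -> X) (v : Y -> nat -> R),
    measurable_fun setT phi -> (forall i, measurable_fun setT (v ^~ i)) ->
    measurable_fun setT (fun y => F (phi y) (v y)).

Definition scons (x : R) v : nat -> R := fun i => if i == 0%N then x else v i.-1.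

Lemma noise_measurable_scons d (X : measurableType d)
    (F : X -> (nat -> R) -> \bar R) : noise_measurable F ->
  @noise_measurable _ (X * R)%type (fun xr v => F xr.1 (scons xr.2 v)).
Proof.
move=> mF d' Y phi v mphi mv; apply: (mF _ _ (fst \o phi)).
  exact: measurableT_comp.
by case=> [|i] //=; [apply: measurableT_comp|exact: mv].
Qed.

Lemma noise_measurable_point d (X : measurableType d)
    (F : X -> (nat -> R) -> \bar R) (x : X) : noise_measurable F ->
  noise_measurable (fun _ : unit => F x).
Proof. by move=> mF d' Y phi v mphi mv; apply: (mF _ _ (cst x)). Qed.

Lemma noise_measurable_sconsr (F : (nat -> R) -> \bar R) :
  noise_measurable (fun _ : unit => F) ->
  noise_measurable (fun (x : R) v => F (scons x v)).
Proof.
move=> mF d' Y phi v mphi mv; apply: (mF _ _ (cst tt) (fun y => scons (phi y) (v y))).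
  exact: measurable_cst.
by case.
Qed.

Lemma gauss_expectS s k (F : (nat -> R) -> \bar R) : s != 0 ->
  gauss_expect s k.+1 F =
  (\int[normal_prob 0 s]_x gauss_expect s k (fun v => F (scons x v)))%E.
Proof. by move=> /negbTE /= ->. Qed.

Lemma gauss_expect_ge0 s k (F : (nat -> R) -> \bar R) :
  (forall v, 0 <= F v)%E -> (0 <= gauss_expect s k F)%E.
Proof.
elim: k F => [|k IH] F F0 //=.
by case: ifP => _; [exact: IH|apply: integral_ge0 => x _; exact: IH].
Qed.

Lemma eq_gauss_expect s k (F1 F2 : (nat -> R) -> \bar R) :
  F1 =1 F2 -> gauss_expect s k F1 = gauss_expect s k F2.
Proof. by move=> /funext ->. Qed.

(** Separates the noise block of one iteration from the blocks of the later ones. *)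
Lemma gauss_expectD_dim s (a b : nat) (F : (nat -> R) -> \bar R) : s != 0 ->
  gauss_expect s (a + b) F =
  gauss_expect s a (fun u => gauss_expect s b
    (fun v => F (fun i => if (i < a)%N then u i else v (i - a)%N))).
Proof.
move=> s0; elim: a F => [|a IH] F.
  rewrite add0n /=; apply: eq_gauss_expect => v.
  by congr F; apply/funext => i; rewrite subn0.
rewrite addSn !gauss_expectS//; apply: eq_integral => x _.
rewrite IH; apply: eq_gauss_expect => u; apply: eq_gauss_expect => v.
by congr F; apply/funext => -[|i].
Qed.

(** Each integration is one use of Tonelli. The coordinate being integrated is first moved into the
    parameter, whose space becomes [X * R]; hence the induction over all parameter spaces. *)
Lemma measurable_gauss_expect s k d (X : measurableType d)
    (F : X -> (nat -> R) -> \bar R) : s != 0 ->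
  (forall x v, 0 <= F x v)%E -> noise_measurable F ->
  measurable_fun setT (fun x => gauss_expect s k (F x)).
Proof.
move=> s0; elim: k d X F => [|k IH] d X F F0 mF.
  by rewrite /=; apply: (mF _ _ id (fun _ _ => 0)) => // i; exact: measurable_cst.
have := IH _ _ _ _ (noise_measurable_scons mF).
move=> /(_ (fun _ _ => F0 _ _)) mG.
pose G (xr : X * R) := gauss_expect s k (fun v => F xr.1 (scons xr.2 v)).
have := @measurable_fun_fubini_tonelli_F _ _ X (measurableTypeR R) R
  (normal_prob 0 s) G mG.
move=> /(_ (fun xr => gauss_expect_ge0 _ _ (fun _ => F0 _ _))).
by under eq_fun do rewrite gauss_expectS//.
Qed.

Section linearity.
Variables (s : R) (s0 : s != 0).
Local Notation nmeas F := (noise_measurable (fun _ : unit => F)).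

Lemma measurable_gauss_expect_scons k (F : (nat -> R) -> \bar R) :
  (forall v, 0 <= F v)%E -> nmeas F ->
  measurable_fun [set: R] (fun x => gauss_expect s k (fun v => F (scons x v))).
Proof.
move=> F0 mF; apply: measurable_gauss_expect => //.
exact: noise_measurable_sconsr.
Qed.

Lemma le_gauss_expect k (F1 F2 : (nat -> R) -> \bar R) :
  (forall v, 0 <= F1 v)%E -> nmeas F1 -> nmeas F2 ->
  (forall v, F1 v <= F2 v)%E ->
  (gauss_expect s k F1 <= gauss_expect s k F2)%E.
Proof.
elim: k F1 F2 => [|k IH] F1 F2 F10 mF1 mF2 F12; first exact: F12.
have F20 v : (0 <= F2 v)%E by exact: le_trans (F12 v).
rewrite !gauss_expectS//; apply: ge0_le_integral => //.
- by move=> x _; exact: gauss_expect_ge0.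
- exact: measurable_gauss_expect_scons.
- exact: measurable_gauss_expect_scons.
- move=> x _; apply: IH => //; exact: noise_measurable_point
    (noise_measurable_sconsr _).
Qed.

Lemma gauss_expectD k (F1 F2 : (nat -> R) -> \bar R) :
  (forall v, 0 <= F1 v)%E -> (forall v, 0 <= F2 v)%E -> nmeas F1 -> nmeas F2 ->
  (gauss_expect s k (fun v => F1 v + F2 v) =
   gauss_expect s k F1 + gauss_expect s k F2)%E.
Proof.
elim: k F1 F2 => [|k IH] F1 F2 F10 F20 mF1 mF2; first by [].
rewrite !gauss_expectS// -ge0_integralD//.
- apply: eq_integral => x _; apply: IH => //; exact: noise_measurable_point
    (noise_measurable_sconsr _).
- by move=> x _; exact: gauss_expect_ge0.
- exact: measurable_gauss_expect_scons.
- by move=> x _; exact: gauss_expect_ge0.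
- exact: measurable_gauss_expect_scons.
Qed.

Lemma gauss_expectZl k (c : R) (F : (nat -> R) -> \bar R) : 0 <= c ->
  (forall v, 0 <= F v)%E -> nmeas F ->
  (gauss_expect s k (fun v => c%:E * F v) = c%:E * gauss_expect s k F)%E.
Proof.
move=> c0; elim: k F => [|k IH] F F0 mF; first by [].
rewrite !gauss_expectS// -ge0_integralZl_EFin//.
- apply: eq_integral => x _; apply: IH => //; exact: noise_measurable_point
    (noise_measurable_sconsr _).
- by move=> x _; exact: gauss_expect_ge0.
- exact: measurable_gauss_expect_scons.
Qed.

Lemma gauss_expect_cst k (c : \bar R) : (0 <= c)%E ->
  gauss_expect s k (fun _ => c) = c.
Proof.
move=> c0; elim: k => [//|k IH].
rewrite gauss_expectS//; under eq_integral do rewrite IH.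
rewrite integral_cst//.
by rewrite [X in (_ * X)%E](@probability_setT _ _ R (normal_prob 0 s)) mule1.
Qed.

Lemma noise_measurable_sum (I : Type) (r : seq I)
    (F : I -> (nat -> R) -> \bar R) :
  (forall i, nmeas (F i)) -> nmeas (fun v => \sum_(i <- r) F i v)%E.
Proof.
move=> mF d' Y phi v mphi mv; apply: emeasurable_sum => i.
exact: (mF i _ _ phi).
Qed.

Lemma gauss_expect_sum k (I : Type) (r : seq I)
    (F : I -> (nat -> R) -> \bar R) :
  (forall i v, 0 <= F i v)%E -> (forall i, nmeas (F i)) ->
  (gauss_expect s k (fun v => \sum_(i <- r) F i v) =
   \sum_(i <- r) gauss_expect s k (F i))%E.
Proof.
move=> F0 mF; elim: r => [|i r IH].
  under eq_gauss_expect do rewrite big_nil.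
  by rewrite big_nil gauss_expect_cst.
under eq_gauss_expect do rewrite big_cons.
rewrite big_cons gauss_expectD ?IH//.
  by move=> v; exact: sume_ge0.
exact: noise_measurable_sum.
Qed.

(* density of N(a, s^2 I_k) with respect to N(0, s^2 I_k) *)
Definition gauss_ratio k (a : nat -> R) v : R :=
  expR (\sum_(i < k) (a i * v i / s ^+ 2 - a i ^+ 2 / (2 * s ^+ 2))).

Lemma gauss_ratio_gt0 k a v : 0 < gauss_ratio k a v.
Proof. exact: expR_gt0. Qed.

Lemma gauss_ratioS k a x v : gauss_ratio k.+1 a (scons x v) =
  expR (a 0%N * x / s ^+ 2 - a 0%N ^+ 2 / (2 * s ^+ 2))
  * gauss_ratio k (fun i => a i.+1) v.
Proof. by rewrite /gauss_ratio big_ord_recl expRD. Qed.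

Lemma measurable_gauss_ratio k a d' (Y : measurableType d') (w : Y -> nat -> R) :
  (forall i, measurable_fun setT (w ^~ i)) ->
  measurable_fun setT (fun y => gauss_ratio k a (w y)).
Proof.
move=> mw; apply: measurableT_comp => //; apply: measurable_sum => i.
apply: measurable_funB => //; apply: measurable_funM => //.
exact: measurable_funM.
Qed.

Lemma noise_measurable_ratioM k a (F : (nat -> R) -> \bar R) : nmeas F ->
  nmeas (fun v => (gauss_ratio k a v)%:E * F v)%E.
Proof.
move=> mF d' Y phi w mphi mw; apply: emeasurable_funM.
  by apply/measurable_EFinP; exact: measurable_gauss_ratio.
exact: (mF _ _ phi).
Qed.

(** Cameron-Martin in dimension [k], one coordinate at a time. The noise is 0 from index [k] on, so
    the shift must vanish there too. *)
Lemma gauss_expect_shift k (a : nat -> R) (F : (nat -> R) -> \bar R) :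
  (forall i, (k <= i)%N -> a i = 0) -> (forall v, 0 <= F v)%E -> nmeas F ->
  (gauss_expect s k (fun v => F (fun i => a i + v i)%R) =
   gauss_expect s k (fun v => (gauss_ratio k a v)%:E * F v))%E.
Proof.
elim: k a F => [|k IH] a F ak F0 mF.
  rewrite /= /gauss_ratio big_ord0 expR0 mul1e; congr F.
  by apply/funext => i; rewrite ak ?addr0.
have mF' x : nmeas (fun v => F (scons x v)).
  exact: noise_measurable_point (noise_measurable_sconsr _).
rewrite !gauss_expectS//.
pose H x := gauss_expect s k
  (fun v => (gauss_ratio k (fun i => a i.+1) v)%:E * F (scons x v))%E.
transitivity (\int[normal_prob 0 s]_x H (a 0%N + x)%R)%E.
  apply: eq_integral => x _; rewrite /H -IH//; first last.
    by move=> i ki; apply: ak.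
  by apply: eq_gauss_expect => v; congr F; apply/funext => -[|i].
have H0 x : (0 <= H x)%E.
  by apply: gauss_expect_ge0 => v; rewrite mule_ge0// lee_fin expR_ge0.
rewrite normal_prob_shift//; last first.
  apply: (@measurable_gauss_expect _ _ _ _ (fun (x : R) v =>
    (gauss_ratio k (fun i => a i.+1) v)%:E * F (scons x v))%E) => //.
    by move=> x v; rewrite mule_ge0// lee_fin expR_ge0.
  move=> d' Y phi w mphi mw; apply: emeasurable_funM.
    by apply/measurable_EFinP; exact: measurable_gauss_ratio.
  exact: (noise_measurable_sconsr mF).
apply: eq_integral => x _; rewrite /H -gauss_expectZl ?expR_ge0//.
- by apply: eq_gauss_expect => v; rewrite gauss_ratioS EFinM muleA.
- by move=> v; rewrite mule_ge0// lee_fin expR_ge0.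
- exact: noise_measurable_ratioM.
Qed.

Lemma gauss_expect_ratio k (a : nat -> R) :
  (forall i, (k <= i)%N -> a i = 0) ->
  gauss_expect s k (fun v => (gauss_ratio k a v)%:E) = 1%E.
Proof.
move=> ak.
have := @gauss_expect_shift k a (fun=> 1%E) ak (fun _ => lee01).
rewrite gauss_expect_cst// => ->.
  by under [RHS]eq_gauss_expect do rewrite mule1.
by move=> d' Y phi w _ _; exact: measurable_cst.
Qed.

End linearity.
End gauss_expect_theory.

(** * Scalar inequalities *)

Section power_inequalities.
Variable R : realType.
Implicit Types t r y q k lam : R.

(** Write the power as exp (- q ln t), then use 1 + y <= exp y and ln t <= t - 1. *)
Lemma powRN_ge_tangent t q : 0 < t -> 0 <= q -> 1 - q * (t - 1) <= t `^ (- q).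
Proof.
move=> t0 q0; rewrite /powR gt_eqF//.
apply: le_trans (expR_ge1Dx _).
rewrite mulNr lerD2l lerN2 ler_wpM2l//.
by have := @le_ln1Dx R (t - 1); rewrite (_ : 1 + (t - 1) = t); [apply|]; lra.
Qed.

Lemma powR_invl t q : 0 <= t -> t^-1 `^ q = t `^ (- q).
Proof. by move=> t0; rewrite -(powR_inv1 t0) -powRrM mulN1r. Qed.

(** Bernoulli: the previous bound at [t^-1] with exponent [q - 1], multiplied by [t]. *)
Lemma powR_ge_tangent t q : 0 < t -> 1 <= q -> 1 + q * (t - 1) <= t `^ q.
Proof.
move=> t0 q1.
have := @powRN_ge_tangent t^-1 (q - 1).
rewrite invr_gt0 subr_ge0 => /(_ t0 q1).
rewrite (powR_invl _ (ltW t0)) opprK => h.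
rewrite -(@mulr_powRB1 _ t q (ltW t0)); last lra.
apply: le_trans (ler_wpM2l (ltW t0) h).
rewrite le_eqVlt; apply/orP; left; apply/eqP; field; lra.
Qed.

Lemma nonincreasing_ge_at1 (f f' : R -> R) s :
  (forall x : R, 0 < x -> is_derive x 1 f (f' x)) ->
  (forall x : R, 0 < x < 1 -> f' x <= 0) -> 0 < s <= 1 -> f 1 <= f s.
Proof.
move=> df f'0 /andP[s0]; rewrite le_eqVlt => /predU1P[->//|s1].
have [||c] := @MVT _ f f' s 1 s1.
- by move=> x; rewrite in_itv/= => /andP[sx _]; apply: df; exact: lt_trans sx.
- apply: derivable_within_continuous => x; rewrite in_itv/= => /andP[sx _].
  by apply: ex_derive; apply: df; exact: lt_le_trans sx.
rewrite in_itv/= => /andP[sc c1] fE.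
rewrite -subr_le0 fE mulr_le0_ge0 ?subr_ge0 ?(ltW s1)//.
by apply: f'0; rewrite c1 (lt_trans s0).
Qed.

(** The difference of the two sides vanishes at 1, and its derivative on (0, 1) is nonpositive by
    Bernoulli with exponent [lam - 1]. *)
Lemma powR_le_taylor2_le1 r lam : 0 < r <= 1 -> 2 <= lam ->
  r `^ lam <= 1 + lam * (r - 1) + lam * (lam - 1) / 2 * (r - 1) ^+ 2.
Proof.
move=> r01 lam2.
pose f x : R := 1 + lam * (x - 1) + lam * (lam - 1) / 2 * (x - 1) ^+ 2
  - x `^ lam.
pose f' x : R := lam + lam * (lam - 1) * (x - 1) - lam * x `^ (lam - 1).
have := @nonincreasing_ge_at1 f f' r.
rewrite {1 2}/f powR1 => /(_ _ _ r01) h; rewrite -subr_ge0.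
apply: le_trans (h _ _); first by rewrite subrr expr0n/= !mulr0; lra.
  move=> x x0; apply: is_deriveB (is_derive1_powR lam x0).
  by apply: is_derive_eq; rewrite /GRing.scale /=; field.
move=> x /andP[x0 x1]; rewrite /f'.
have := @powR_ge_tangent x (lam - 1) x0; rewrite lerBrDr => /(_ lam2).
nra.
Qed.

(** The substitution s = 1/r brings the problem to (0, 1]: after division by r^lam the claim reads f
    1 <= f s, with f' proportional to (1 - x) (x^(lam - 2) - 1). *)
Lemma powR_le_taylor2_ge1 r lam : 1 <= r -> 2 <= lam ->
  r `^ lam <= 1 + lam * (r - 1)
              + lam * (lam - 1) / 2 * (r - 1) ^+ 2 * r `^ (lam - 2).
Proof.
move=> r1 lam2; have r0 : 0 < r by lra.
pose s := r^-1.
have s01 : 0 < s <= 1 by rewrite invr_gt0 r0 invf_le1.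
pose f x : R := x `^ lam + lam * (x `^ (lam - 1) * (1 - x))
  + lam * (lam - 1) / 2 * (1 - x) ^+ 2.
pose f' x : R := lam * (lam - 1) * ((1 - x) * (x `^ (lam - 2) - 1)).
have : f 1 <= f s.
  apply: (@nonincreasing_ge_at1 f f') => //.
    move=> x x0.
    have d1 : is_derive x 1 (fun x : R => 1 - x) (-1).
      by apply: is_derive_eq; rewrite /GRing.scale /=; ring.
    have d2 : is_derive x 1 (fun x : R => lam * (lam - 1) / 2 * (1 - x) ^+ 2)
        (- (lam * (lam - 1) * (1 - x))).
      by apply: is_derive_eq; rewrite /GRing.scale /=; field.
    have dM := is_deriveM (is_derive1_powR (lam - 1) x0) d1.
    have dD := is_deriveD
      (is_deriveD (is_derive1_powR lam x0) (is_deriveZ lam dM)) d2.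
    apply: (is_derive_eq dD).
    rewrite /f' /GRing.scale /=.
    have -> : x `^ (lam - 1) = x * x `^ (lam - 2).
      by rewrite -(@mulr_powRB1 _ x (lam - 1) (ltW x0)); [congr (_ * _ `^ _)|]; lra.
    have -> : lam - 1 - 1 = lam - 2 by lra.
    ring.
  move=> x /andP[x0 x1]; rewrite /f'.
  have : x `^ (lam - 2) <= 1.
    by rewrite -[leRHS](powRr0 x); apply: ger_powR; [rewrite x0 ltW|lra].
  set u := x `^ _ => u1.
  have h1 : 0 <= (1 - x) * (1 - u) by rewrite mulr_ge0; lra.
  have h2 : 0 <= lam * (lam - 1) by rewrite mulr_ge0; lra.
  have := mulr_ge0 h2 h1; lra.
rewrite /f powR1 subrr expr0n/= !mulr0 !addr0.
have rl : 0 < r `^ lam by exact: powR_gt0.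
rewrite -(ler_pM2l rl) mulr1 => /le_trans; apply.
have rn0 : r != 0 by rewrite gt_eqF.
have rB b c : r `^ (b - c) = r `^ b / r `^ c by rewrite powRB// rn0 implybT.
have -> : s `^ lam = (r `^ lam)^-1 by rewrite /s (powR_invl _ (ltW r0)) powRN.
have -> : s `^ (lam - 1) = (r `^ lam)^-1 * r.
  by rewrite /s (powR_invl _ (ltW r0)) powRN rB (powRr1 (ltW r0)) invf_div mulrC.
rewrite rB (powR_mulrn 2 (ltW r0)).
rewrite le_eqVlt; apply/orP; left; apply/eqP.
rewrite /s; field.
by rewrite !gt_eqF.
Qed.

Lemma powR_le_tangent t q : 0 < t -> 0 <= q <= 1 -> t `^ q <= 1 + q * (t - 1).
Proof.
move=> t0 /andP[]; rewrite le_eqVlt => /predU1P[<-|q0] q1.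
  by rewrite powRr0 mul0r addr0.
have := @powR_ge_tangent (t `^ q) q^-1.
rewrite powR_gt0// -powRrM mulfV ?gt_eqF// (powRr1 (ltW t0)) => /(_ isT).
rewrite invf_ge1//; move=> /(_ q1) /(ler_wpM2l (ltW q0)).
rewrite mulrDr mulrA mulfV ?gt_eqF//; lra.
Qed.

(** Concave Bernoulli for r^(lam - 1), multiplied by [r]. *)
Lemma powR_le_quadratic r lam : 0 <= r -> 1 <= lam <= 2 ->
  r `^ lam <= 1 + lam * (r - 1) + (lam - 1) * (r - 1) ^+ 2.
Proof.
rewrite le_eqVlt => /predU1P[<-|r0] /andP[l1 l2].
  by rewrite powR0 ?gt_eqF; lra.
have l01 : 0 <= lam - 1 <= 1 by lra.
have := powR_le_tangent r0 l01.
rewrite -(@mulr_powRB1 _ r lam (ltW r0)); last lra.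
nra.
Qed.
End power_inequalities.

(** * Numerical constants and tail moments *)

Section moment_constants.
Variable R : realType.
Implicit Types t r y q k lam p x : R.

(** The bound 1 - u <= exp (- u) at u = x / (n + 1), raised to the power n + 1 and inverted; it
    yields rational upper bounds on exponentials. *)
Lemma expR_le_invX (n : nat) x : 0 <= x < n.+1%:R ->
  expR x <= ((1 - x / n.+1%:R) ^+ n.+1)^-1.
Proof.
move=> /andP[x0 xn].
have n0 : 0 < n.+1%:R :> R by rewrite ltr0n.
have u1 : 0 < 1 - x / n.+1%:R by rewrite subr_gt0 ltr_pdivrMr// mul1r.
rewrite -[leLHS]invrK -expRN lef_pV2 ?posrE ?exprn_gt0 ?expR_gt0//.
rewrite (_ : - x = n.+1%:R * (- (x / n.+1%:R))); last by field; rewrite gt_eqF.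
rewrite expRM_natl lerXn2r ?nnegrE ?(ltW u1) ?expR_ge0//.
exact: expR_ge1Dx.
Qed.

Lemma expR_half_le : expR (1 / 2 : R) <= 12 / 7.
Proof.
have := @expR_le_invX 7 (1 / 2); rewrite (_ : _ <= _ < _); last lra.
move=> /(_ isT) /le_trans; apply.
by rewrite -[leRHS]invf_div lef_pV2 ?posrE; lra.
Qed.

Lemma expR_3_4_le : expR (3 / 4 : R) <= 54 / 25.
Proof.
have := @expR_le_invX 15 (3 / 4); rewrite (_ : _ <= _ < _); last lra.
move=> /(_ isT) /le_trans; apply.
by rewrite -[leRHS]invf_div lef_pV2 ?posrE; lra.
Qed.

(** Source of the constant 7/2. On (0, 3/2] the function exp (x / 2) lies below its chord,
    controlled by exp (3/4) <= 54/25, and 2 * 54/25 * 2/3 * 29/25 < 7/2. *)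
Lemma chi2_constant_le x : 0 < x <= 3 / 2 ->
  2 * expR (x / 2) * (expR (x / 2) - 1) <= 7 / 2 * x.
Proof.
move=> /andP[x0 x1].
have e1 := expR_3_4_le.
have e0 : 1 <= expR (3 / 4 : R) by rewrite -[leLHS](expR0 R) ler_expR; lra.
have : expR (x / 2) <= 1 + (2 / 3 * x) * (expR (3 / 4) - 1).
  rewrite (_ : x / 2 = 3 / 4 * (2 / 3 * x)); last by field.
  by rewrite expRM; apply: powR_le_tangent; [exact: expR_gt0|lra].
have : 1 <= expR (x / 2) by rewrite -[leLHS](expR0 R) ler_expR; lra.
set u := expR (x / 2); set w := expR _ in e0 e1 *.
move=> u1 u2.
have u3 : u - 1 <= 2 / 3 * (29 / 25) * x by nra.
have u4 : u <= 54 / 25 by nra.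
nra.
Qed.

(** The threshold is y = 1 / (2 k). Below it r^k <= exp (k (r - 1)) <= exp (1/2); above it 1 < 2 k
    y, so r <= 1 + y <= (2 k + 1) y and the term is bounded by a pure power of y. *)
Lemma sqrM_powR_le_tail r y k : 1 < k -> 1 < r -> r <= 1 + y ->
  (r - 1) ^+ 2 * r `^ k
  <= expR (1 / 2) * (r - 1) ^+ 2 + (2 * k + 1) `^ k * y `^ (k + 2).
Proof.
move=> k1 r1 ry; have r0 : 0 < r by lra.
have y0 : 0 <= y by lra.
have Dy0 : 0 <= (2 * k + 1) `^ k * y `^ (k + 2) by rewrite mulr_ge0 ?powR_ge0.
have r12 := sqr_ge0 (r - 1).
have [yk|yk] := leP y (2 * k)^-1.
  have : r `^ k <= expR (1 / 2).
    rewrite /powR gt_eqF// ler_expR.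
    have : ln r <= r - 1.
      by have := @le_ln1Dx R (r - 1); rewrite (_ : 1 + (r - 1) = r); [apply|]; lra.
    move=> /(ler_wpM2l (ltW (lt_trans ltr01 k1))) /le_trans; apply.
    have : k * (r - 1) <= k * (2 * k)^-1 by rewrite ler_pM2l; lra.
    rewrite (_ : k * (2 * k)^-1 = 1 / 2)//; field; lra.
  move=> h; have := ler_wpM2l r12 h; lra.
have k20 : 0 < 2 * k by lra.
have yk' : 1 < 2 * k * y.
  have : 2 * k * (2 * k)^-1 < 2 * k * y by rewrite ltr_pM2l.
  by rewrite mulfV ?gt_eqF.
have y1 : 0 < y by nra.
have h : r `^ k <= (2 * k + 1) `^ k * y `^ k.
  rewrite -powRM; [|lra..]; apply: ge0_ler_powR; rewrite ?nnegrE; nra.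
have yl : y `^ (k + 2) = y ^+ 2 * y `^ k.
  by rewrite powRD ?(gt_eqF y1) ?implybT// (powR_mulrn 2 y0) mulrC.
rewrite yl; have h2 : (r - 1) ^+ 2 <= y ^+ 2 by rewrite lerXn2r ?nnegrE; lra.
have := ler_pM r12 (powR_ge0 r k) h2 h.
have : 0 <= expR (1 / 2) * (r - 1) ^+ 2 by rewrite mulr_ge0 ?expR_ge0.
lra.
Qed.

(** This is the tail moment of order k + 2 after division by p^2. The k-th power of the assumption
    supplies exp (- 3/2 k (k + 1) x), which outweighs the exponential of the moment and leaves exp
    (- (k + 1) (k - 1) x). *)
Lemma tail_moment_le p x k : 1 < k -> 0 < p -> 0 < x ->
  p * expR (3 / 2 * (k + 1) * x) <= x / (1 + x) / (k + 2) ->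
  (2 * k + 1) `^ k * (p `^ k * expR ((k + 2) * (k + 1) * x / 2)) <= x.
Proof.
move=> k1 p0 x0; set X := x / (1 + x) => hp.
have X0 : 0 < X by rewrite divr_gt0//; lra.
have Xx : X <= x by rewrite ler_pdivrMr; nra.
pose Q := (2 * k + 1) / (k + 2).
have Q0 : 0 < Q by rewrite divr_gt0; lra.
have QX0 : 0 < Q * X by rewrite mulr_gt0.
have Q2 : Q <= 2 by rewrite ler_pdivrMr; lra.
have Qh : Q <= 1 + (k - 1) / 2 by rewrite ler_pdivrMr; nra.
have h1 : (2 * k + 1) * p <= Q * X * expR (- (3 / 2 * (k + 1) * x)).
  rewrite expRN ler_pdivlMr ?expR_gt0// -[leLHS]mulrA.
  rewrite (_ : Q * X = (2 * k + 1) * (X / (k + 2))); last first.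
    by rewrite /Q; field; lra.
  rewrite ler_pM2l; last lra.
  exact: hp.
have h2 : ((2 * k + 1) * p) `^ k
    <= (Q * X) `^ k * expR (- (3 / 2 * (k + 1) * x) * k).
  rewrite expRM -powRM ?expR_ge0 ?(ltW QX0)//.
  apply: ge0_ler_powR; rewrite ?nnegrE//; [lra| |].
    by rewrite mulr_ge0; lra.
  exact: mulr_ge0 (ltW QX0) (expR_ge0 _).
rewrite mulrA -powRM; [|lra..].
apply: le_trans (ler_wpM2r (expR_ge0 _) h2) _.
rewrite -[leLHS]mulrA -expRD.
rewrite (_ : _ + _ = - (k + 1) * x * (k - 1)); last by field.
(* One factor [Q * X] is kept. The remaining power k - 1 is paired with the exponential; its base is
   at most 1/2, and 2^(1 - k) absorbs [Q]. *)
rewrite expRM -(@mulr_powRB1 _ (Q * X) k); [|exact: ltW|lra].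
rewrite -[leLHS]mulrA -powRM; [|exact: ltW|exact: expR_ge0].
have w : Q * X * expR (- (k + 1) * x) <= 2^-1.
  have : X * expR (- (k + 1) * x) <= 1 / 4.
    rewrite mulNr expRN ler_pdivrMr ?expR_gt0//.
    rewrite /X ler_pdivrMr; last lra.
    have : 1 + 2 * x <= expR ((k + 1) * x).
      by apply: le_trans (expR_ge1Dx _); nra.
    nra.
  have := mulr_ge0 (ltW X0) (expR_ge0 (- (k + 1) * x)).
  nra.
have w0 : 0 <= Q * X * expR (- (k + 1) * x).
  exact: mulr_ge0 (ltW QX0) (expR_ge0 _).
have : (Q * X * expR (- (k + 1) * x)) `^ (k - 1) <= 2^-1 `^ (k - 1).
  by apply: ge0_ler_powR; rewrite ?nnegrE//; lra.
have : 2^-1 `^ (k - 1) * (1 + (k - 1) / 2) <= (1 : R).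
  have := @powRN_ge_tangent R 2^-1 (k - 1).
  rewrite powRN => /(_ ltac:(lra) ltac:(lra)) h.
  rewrite mulrC -ler_pdivlMr ?powR_gt0//; lra.
set z' := 2^-1 `^ (k - 1); set z := _ `^ (k - 1).
have z0 : 0 <= z by exact: powR_ge0.
have z'0 : 0 <= z' by exact: powR_ge0.
move=> h3 h4.
have Qz' : Q * z' <= 1 by rewrite mulrC (le_trans _ h3)// ler_wpM2l.
have Qz : Q * z <= Q * z' by rewrite ler_pM2l.
rewrite mulrAC; apply: le_trans (ler_wpM2r (ltW X0) (le_trans Qz Qz')) _.
by rewrite mul1r.
Qed.

(* The second-order remainder of [r `^ lam] splits into a chi-square part and
   a tail [y `^ q]; the tail is only felt when [2 < lam], and the assumption on
   [p] makes its moment negligible. *)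
Lemma powR_remainder_split lam p x : 1 < lam -> 0 < p -> 0 < x <= 3 / 2 ->
  p * (lam * (1 + x^-1)) * expR (3 / 2 * (lam - 1) * x) <= 1 ->
  exists a D q : R, [/\ 0 <= a, 0 <= D, 1 <= q,
    forall r y, 0 < r -> 0 <= y -> r <= 1 + y ->
      r `^ lam <= 1 + lam * (r - 1)
        + lam * (lam - 1) / 2 * (a * (r - 1) ^+ 2 + D * y `^ q) &
    a * (7 / 2 * x) * p ^+ 2 + D * (p `^ q * expR (q * (q - 1) * x / 2))
      <= 7 * p ^+ 2 * x].
Proof.
move=> l1 p0 /andP[x0 x1] hp.
have px2 : 0 <= p ^+ 2 * x by rewrite mulr_ge0 ?sqr_ge0 ?ltW.
have [l2|l2] := leP lam 2.
  (* For lam <= 2 the quadratic bound suffices without a tail; a = 2 / lam turns lam (lam - 1) / 2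
     into its coefficient lam - 1. *)
  exists (2 / lam), 0, 2; split=> //.
  - by rewrite divr_ge0//; lra.
  - lra.
  - move=> r y r0 y0 ry; rewrite mul0r addr0.
    apply: le_trans (powR_le_quadratic (ltW r0) _) _; first lra.
    rewrite lerD2l le_eqVlt; apply/orP; left; apply/eqP; field; lra.
  - rewrite mul0r addr0.
    have : 2 / lam <= 2 by rewrite ler_pdivrMr; lra.
    nra.
have hp' : p * expR (3 / 2 * (lam - 1) * x) <= (x / (1 + x)) / lam.
  move: hp; set e := expR _ => hp.
  rewrite ler_pdivlMr ?ler_pdivlMr; [|lra..].
  rewrite -(ler_pM2r x0) in hp.
  apply: le_trans (le_trans hp _); last lra.
  rewrite le_eqVlt; apply/orP; left; apply/eqP; field; lra.
have X0 : 0 < x / (1 + x) by rewrite divr_gt0//; lra.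
have Xx : x / (1 + x) <= x by rewrite ler_pdivrMr; nra.
have pe0 : 0 < expR (3 / 2 * (lam - 1) * x) by exact: expR_gt0.
have c0 : 0 < lam * (lam - 1) / 2 by rewrite !mulr_gt0; lra.
have rem_le1 r y q a D : 1 <= a -> 0 <= D -> 0 < r -> r <= 1 ->
    r `^ lam <= 1 + lam * (r - 1)
        + lam * (lam - 1) / 2 * (a * (r - 1) ^+ 2 + D * y `^ q).
  move=> a1 D0 r0 r1; apply: le_trans (powR_le_taylor2_le1 _ (ltW l2)) _.
    by rewrite r0.
  rewrite lerD2l (ler_pM2l c0).
  have : 0 <= D * y `^ q by rewrite mulr_ge0 ?powR_ge0.
  have := sqr_ge0 (r - 1); nra.
have [l3|l3] := leP lam 3.
  (* For 2 < lam <= 3, concavity gives r^(lam - 2) <= 1 + (lam - 2) y, so the tail is cubic with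
     factor lam - 2. *)
  exists 1, (lam - 2), 3; split=> //; try lra.
  - move=> r y r0 y0 ry; have [r1|r1] := leP r 1; first by apply: rem_le1; lra.
    apply: le_trans (powR_le_taylor2_ge1 (ltW r1) (ltW l2)) _.
    rewrite lerD2l -[leLHS]mulrA (ler_pM2l c0).
    rewrite (powR_mulrn 3 y0).
    have : r `^ (lam - 2) <= 1 + (lam - 2) * y.
      apply: le_trans (powR_le_tangent r0 _) _; first lra.
      by rewrite lerD2l ler_wpM2l; lra.
    have s0 : 0 <= r - 1 <= y by lra.
    have : (r - 1) ^+ 2 <= y ^+ 2 by rewrite lerXn2r ?nnegrE; lra.
    move=> h2 h1; apply: le_trans (ler_wpM2l (sqr_ge0 _) h1) _.
    have : 0 <= (lam - 2) * y by rewrite mulr_ge0; lra.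
    nra.
  - rewrite (powR_mulrn 3 (ltW p0)) mul1r.
    suff : (lam - 2) * (p * expR (3 * (3 - 1) * x / 2)) <= 7 / 2 * x.
      move=> h; have := ler_wpM2l (sqr_ge0 p) h.
      set E := expR _; lra.
    (* The exponent 3 x exceeds the one in [hp'] by at most 3/2 x <= 9/4, whence the cube of exp
       (3/4). The final product 1/3 * 21/2 is exactly 7/2. *)
    have e3 : expR (3 * (3 - 1) * x / 2)
        <= expR (3 / 2 * (lam - 1) * x) * (expR (3 / 4)) ^+ 3.
      rewrite -expRM_natl -expRD ler_expR; nra.
    have e4 : expR (3 / 4 : R) ^+ 3 <= 21 / 2.
      apply: (@le_trans _ _ ((54 / 25) ^+ 3)); last lra.
      by rewrite lerXn2r ?nnegrE ?expR_ge0 ?expR_3_4_le//; lra.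
    have l01 : (lam - 2) / lam <= 1 / 3 by rewrite ler_pdivrMr; lra.
    have : p * expR (3 * (3 - 1) * x / 2) <= x / lam * (21 / 2).
      apply: le_trans (ler_wpM2l (ltW p0) e3) _; rewrite mulrA.
      apply: ler_pM; rewrite ?mulr_ge0 ?exprn_ge0 ?expR_ge0 ?(ltW p0)//.
      by apply: le_trans hp' _; rewrite ler_pM2r// invr_gt0; lra.
    move=> h; apply: le_trans (ler_wpM2l _ h) _; first lra.
    have -> : (lam - 2) * (x / lam * (21 / 2)) = (lam - 2) / lam * x * (21 / 2).
      by field; lra.
    nra.
(* For lam > 3 the tail has order lam. As exp (1/2) <= 12/7, the chi-square part uses at most 6 p^2
   x of the budget 7 p^2 x and leaves p^2 x for the tail. *)
exists (expR (1 / 2)), ((2 * (lam - 2) + 1) `^ (lam - 2)), lam.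
have eh1 : 1 <= expR (1 / 2 : R) by rewrite -[leLHS](expR0 R) ler_expR; lra.
have l2E : lam = lam - 2 + 2 by lra.
have k1 : 1 < lam - 2 by lra.
split; [lra|exact: powR_ge0|lra| |].
- move=> r y r0 y0 ry; have [r1|r1] := leP r 1.
    by apply: rem_le1 => //; exact: powR_ge0.
  apply: le_trans (powR_le_taylor2_ge1 (ltW r1) (ltW l2)) _.
  rewrite lerD2l -[leLHS]mulrA (ler_pM2l c0) [in y `^ lam]l2E.
  exact: sqrM_powR_le_tail.
- have pl : p `^ lam = p ^+ 2 * p `^ (lam - 2).
    rewrite [in LHS]l2E powRD ?(gt_eqF p0) ?implybT//.
    by rewrite (powR_mulrn 2 (ltW p0)) mulrC.
  have := @tail_moment_le p x (lam - 2) k1 p0 x0.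
  have -> : lam - 2 + 1 = lam - 1 by lra.
  rewrite -l2E => /(_ hp') h.
  have := ler_wpM2l (sqr_ge0 p) h; rewrite pl.
  have := ler_wpM2r px2 expR_half_le.
  set E := expR (lam * _ * _ / 2); set F := expR (1 / 2); clear; lra.
Qed.

End moment_constants.

(** * Moments of ratios of Gaussian mixtures *)

Section renyi_bound.
Variable R : realType.

(** Bounds the Gaussian mean of (u - u')^2 / e_j, whose terms are these exponentials. With a, b, xi
    the exponentials of A/2, B/2, x/2, the condition gives exp C >= a b / xi; the rest is polynomial
    on 1 <= a <= b <= xi, with equality at a = b = xi. *)
Lemma chi2_exponents_le (A B C x : R) : 0 <= A <= x -> 0 <= B <= x ->
  A + B - x <= 2 * C ->
  expR A + expR B - 2 * expR C <= 2 * expR (x / 2) * (expR (x / 2) - 1).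
Proof.
move=> /andP[A0 Ax] /andP[B0 Bx] hC.
wlog AB : A B A0 Ax B0 Bx hC / A <= B => [hw|].
  have [|/ltW] := leP A B; first exact: hw.
  rewrite (addrC (expR A)); apply: hw => //; lra.
have sq (u : R) : expR u = expR (u / 2) ^+ 2.
  by rewrite -expRM_natl; congr expR; field.
have C0 : expR (A / 2) * expR (B / 2) <= expR C * expR (x / 2).
  by rewrite -!expRD ler_expR; lra.
rewrite (sq A) (sq B).
have a1 : 1 <= expR (A / 2) by rewrite -[leLHS](expR0 R) ler_expR; lra.
have ab : expR (A / 2) <= expR (B / 2) by rewrite ler_expR; lra.
have bx : expR (B / 2) <= expR (x / 2) by rewrite ler_expR; lra.
move: C0 a1 ab bx.
set a := expR (A / 2); set b := expR (B / 2); set xi := expR (x / 2).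
set c := expR C; clearbody a b xi c => {sq} C0 a1 ab bx.
have x0 : 0 < xi by lra.
have b0 : 0 < b by lra.
rewrite -(ler_pM2r x0).
have h1 : 0 <= (b - a) * (b + a - 2) by rewrite mulr_ge0; lra.
have h2 : 0 <= (xi - b) * (b - a) by rewrite mulr_ge0; lra.
have h3 : 0 <= (xi - b) * xi by rewrite mulr_ge0; lra.
have h4 : 0 <= (xi - b) * (xi + b) by rewrite mulr_ge0; lra.
have h5 : 0 <= (xi ^+ 2 - a * b) * (xi - b) by rewrite mulr_ge0; nra.
have h6 : 0 <= (xi ^+ 2 - b ^+ 2) * (b - 1) by rewrite mulr_ge0; nra.
have h7 : 0 <= (b - a) * (xi - b) * (b - a) by rewrite !mulr_ge0; lra.
nra.
Qed.

Section gauss_mean.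
Variables (s : R) (s0 : s != 0) (k : nat).
Local Notation ratio := (gauss_ratio s k).

Definition noise_measurableR (h : (nat -> R) -> R) : Prop :=
  forall d' (Y : measurableType d') (v : Y -> nat -> R),
    (forall i, measurable_fun setT (v ^~ i)) ->
    measurable_fun setT (fun y => h (v y)).

Lemma noise_measurable_EFin h : noise_measurableR h ->
  noise_measurable (fun _ : unit => EFin \o h).
Proof.
by move=> mh d' Y phi v _ mv; apply/measurable_EFinP; exact: mh.
Qed.

Lemma noise_measurable_ratio a : noise_measurableR (ratio a).
Proof. by move=> d' Y v mv; exact: measurable_gauss_ratio. Qed.

Definition gauss_mean (h : (nat -> R) -> R) (c : R) : Prop :=
  [/\ forall v, 0 <= h v, noise_measurableR h &
      gauss_expect s k (EFin \o h) = c%:E].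

Lemma gauss_meanD h1 h2 c1 c2 : gauss_mean h1 c1 -> gauss_mean h2 c2 ->
  gauss_mean (fun v => h1 v + h2 v) (c1 + c2).
Proof.
move=> [h10 mh1 E1] [h20 mh2 E2]; split.
- by move=> v; rewrite addr_ge0.
- by move=> d' Y v mv; apply: measurable_funD; [exact: mh1|exact: mh2].
- rewrite EFinD -E1 -E2 -gauss_expectD//; exact: noise_measurable_EFin.
Qed.

Lemma gauss_meanZ h c b : 0 <= b -> gauss_mean h c ->
  gauss_mean (fun v => b * h v) (b * c).
Proof.
move=> b0 [h0 mh E]; split.
- by move=> v; rewrite mulr_ge0.
- by move=> d' Y v mv; apply: measurable_funM => //; exact: mh.
- rewrite EFinM -E -gauss_expectZl//; exact: noise_measurable_EFin.
Qed.

Lemma gauss_mean_sum n (h : 'I_n -> (nat -> R) -> R) c :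
  (forall j, gauss_mean (h j) (c j)) ->
  gauss_mean (fun v => \sum_j h j v) (\sum_j c j).
Proof.
move=> H; split.
- by move=> v; apply: sumr_ge0 => j _; case: (H j).
- move=> d' Y v mv; apply: measurable_sum => j.
  by case: (H j) => _ mh _; exact: mh.
- rewrite -sumEFin.
  rewrite (_ : EFin \o _ = fun v => (\sum_j (EFin \o h j) v)%E); last first.
    by apply/funext => v /=; rewrite -sumEFin.
  rewrite gauss_expect_sum//.
  + by apply: eq_bigr => j _; case: (H j).
  + by move=> j v; case: (H j) => h0 _ _; rewrite lee_fin.
  + by move=> j; apply: noise_measurable_EFin; case: (H j).
Qed.

Lemma gauss_mean_ratio (a : nat -> R) :
  (forall i, (k <= i)%N -> a i = 0) -> gauss_mean (ratio a) 1.
Proof.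
move=> ak; split.
- by move=> v; exact/ltW/gauss_ratio_gt0.
- exact: noise_measurable_ratio.
- exact: gauss_expect_ratio.
Qed.

Lemma eq_gauss_mean h1 h2 c : h1 =1 h2 -> gauss_mean h1 c -> gauss_mean h2 c.
Proof. by move=> /funext ->. Qed.

(** Extended-real integrals cannot be subtracted freely, so the negative terms [h1] stay on the
    smaller side and only their finite mean is subtracted. *)
Lemma gauss_expect_le_mean (f h1 h2 : (nat -> R) -> R) c1 c2 :
  (forall v, 0 <= f v) -> noise_measurableR f ->
  gauss_mean h1 c1 -> gauss_mean h2 c2 -> (forall v, f v + h1 v <= h2 v) ->
  (gauss_expect s k (EFin \o f) <= (c2 - c1)%:E)%E.
Proof.
move=> f0 mf [h10 mh1 E1] [h20 mh2 E2] le12.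
rewrite EFinB leeBrDr// -E1 -E2 -gauss_expectD//; last 2 first.
- exact: noise_measurable_EFin.
- exact: noise_measurable_EFin.
apply: le_gauss_expect => //.
- by move=> v; rewrite adde_ge0// lee_fin.
- move=> d' Y phi v mphi mv; apply: emeasurable_funD.
    by apply/measurable_EFinP; exact: mf.
  by apply/measurable_EFinP; exact: mh1.
- exact: noise_measurable_EFin.
Qed.

Definition sqdist (a c : nat -> R) := \sum_(i < k) (a i - c i) ^+ 2.

Lemma gauss_ratio_powR (a c : nat -> R) v q :
  ratio a v `^ q * ratio c v `^ (- (q - 1)) =
  expR (q * (q - 1) * (sqdist a c / s ^+ 2) / 2)
  * ratio (fun i => q * a i - (q - 1) * c i) v.
Proof.
rewrite /gauss_ratio -!expRM -!expRD; congr expR.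
rewrite /sqdist !mulr_suml mulr_sumr !mulr_suml -!big_split /=.
by apply: eq_bigr => i _; field.
Qed.

(** The exponents 1, 1, -1 again sum to 1. This cross term of the chi-square moment enters with a
    minus sign, so an upper bound on it would be of no use. *)
Lemma gauss_ratio_cross (a b c : nat -> R) v :
  ratio a v * ratio b v * (ratio c v)^-1 =
  expR ((sqdist a c + sqdist b c - sqdist a b) / s ^+ 2 / 2)
  * ratio (fun i => a i + b i - c i) v.
Proof.
rewrite /gauss_ratio -!expRN -!expRD; congr expR.
rewrite /sqdist -!sumrN -!big_split /= !mulr_suml -!big_split /=.
by apply: eq_bigr => i _; field.
Qed.

(* Jensen for [t |-> t `^ (- b)], from its tangent at the mean. *)
Lemma powRN_mean_le n (t : 'I_n -> R) b : (0 < n)%N -> 0 <= b ->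
  (forall j, 0 < t j) ->
  (n%:R^-1 * \sum_j t j) `^ (- b) <= n%:R^-1 * \sum_j t j `^ (- b).
Proof.
move=> n0 b0 t0; set m := _ * _.
have n0' : 0 < n%:R :> R by rewrite ltr0n.
have m0 : 0 < m.
  rewrite mulr_gt0 ?invr_gt0// (bigD1 (Ordinal n0))//=.
  by rewrite ltr_pwDl// sumr_ge0// => j _; exact: ltW.
have h : \sum_(j < n) (1 - b * (t j / m - 1)) <= \sum_j (t j / m) `^ (- b).
  by apply: ler_sum => j _; apply: powRN_ge_tangent => //; exact: divr_gt0.
have e1 : \sum_(j < n) (1 - b * (t j / m - 1)) = n%:R.
  rewrite sumrB sumr_const card_ord -mulr_sumr sumrB sumr_const card_ord.
  rewrite -mulr_suml (_ : \sum_j t j = n%:R * m); last first.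
    by rewrite /m mulrA mulfV ?mul1r// gt_eqF.
  by rewrite mulfK ?gt_eqF// subrr mulr0 subr0.
have e2 : \sum_j (t j / m) `^ (- b) = (\sum_j t j `^ (- b)) * m `^ b.
  rewrite mulr_suml; apply: eq_bigr => j _.
  rewrite powRM ?(ltW (t0 j)) ?invr_ge0 ?(ltW m0)//.
  by rewrite powR_invl ?(ltW m0)// opprK.
move: h; rewrite e1 e2 => h.
rewrite powRN -[leLHS]div1r ler_pdivrMr ?powR_gt0// -mulrA ler_pdivlMl//.
by rewrite mulr1.
Qed.

(** Here r = m / m' satisfies r - 1 = p (u - u') / m' and r <= 1 + p u / m'. Multiplying the
    expansion by m' leaves negative powers of m', which Jensen turns into averages over [t j].
    Negative terms sit on the left to suit [gauss_expect_le_mean]. *)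
Lemma mixture_powR_le n (t : 'I_n -> R) (u u' m m' p lam a D q : R) :
  (0 < n)%N -> p = n%:R^-1 -> (forall j, 0 < t j) -> 0 < u -> 0 < u' ->
  m' = p * \sum_j t j -> m = m' + p * (u - u') -> 0 < m ->
  0 <= a -> 0 <= D -> 1 <= q -> 1 < lam ->
  (forall r y, 0 < r -> 0 <= y -> r <= 1 + y ->
      r `^ lam <= 1 + lam * (r - 1)
        + lam * (lam - 1) / 2 * (a * (r - 1) ^+ 2 + D * y `^ q)) ->
  m' * (m / m') `^ lam
    + (lam * m' + lam * (lam - 1) / 2 * a * p ^+ 2
         * (p * \sum_j 2 * (u * u' * (t j)^-1)))
  <= m' + lam * m + (lam * (lam - 1) / 2 * a * p ^+ 2
         * (p * \sum_j (u ^+ 2 * (t j)^-1 + u' ^+ 2 * (t j)^-1))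
       + lam * (lam - 1) / 2 * D * p `^ q
         * (p * \sum_j (u `^ q * t j `^ (- (q - 1))))).
Proof.
move=> n0 pE t0 u0 u'0 m'E mE m0 a0 D0 q1 l1 H.
have p0 : 0 < p by rewrite pE invr_gt0 ltr0n.
have m'0 : 0 < m'.
  rewrite m'E mulr_gt0// (bigD1 (Ordinal n0))//=.
  by rewrite ltr_pwDl// sumr_ge0// => j _; exact: ltW.
have rE : m / m' - 1 = p * (u - u') / m' by rewrite mE; field; lra.
have y0 : 0 <= p * u / m' by rewrite divr_ge0 ?mulr_ge0 ?ltW.
have ry : m / m' <= 1 + p * u / m'.
  have : 0 <= p * u' / m' by rewrite divr_ge0 ?mulr_ge0 ?ltW.
  by rewrite mE !mulrDl mulrBr mulrBl mulfV ?gt_eqF//; lra.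
rewrite -lerBrDr.
apply: le_trans (ler_wpM2l (ltW m'0) (H _ _ (divr_gt0 m0 m'0) y0 ry)) _.
rewrite rE.
set c := lam * (lam - 1) / 2.
have c0 : 0 <= c by rewrite /c !mulr_ge0; lra.
clearbody c.
have J1 : m'^-1 <= p * \sum_j (t j)^-1.
  have := @powRN_mean_le n t 1 n0 ler01 t0.
  rewrite -pE -m'E (powR_inv1 (ltW m'0)).
  by under eq_bigr do rewrite (powR_inv1 (ltW (t0 _))).
have J2 := @powRN_mean_le n t (q - 1) n0 _ t0.
rewrite subr_ge0 -pE -m'E in J2; have {}J2 := J2 q1.
have yE : m' * (p * u / m') `^ q = p `^ q * u `^ q * m' `^ (- (q - 1)).
  rewrite powRM ?mulr_ge0 ?invr_ge0 ?ltW// powRM ?ltW//.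
  rewrite powR_invl ?ltW// mulrCA; congr (_ * _).
  have -> : - (q - 1) = 1 + - q by lra.
  by rewrite powRD ?(gt_eqF m'0) ?implybT// powRr1 ?ltW.
have e1 : \sum_j (u ^+ 2 * (t j)^-1 + u' ^+ 2 * (t j)^-1)
    = (u ^+ 2 + u' ^+ 2) * \sum_j (t j)^-1.
  by rewrite mulr_sumr; apply: eq_bigr => j _; rewrite mulrDl.
have e2 : \sum_j 2 * (u * u' * (t j)^-1)
    = 2 * (u * u') * \sum_j (t j)^-1.
  by rewrite mulr_sumr; apply: eq_bigr => j _; rewrite mulrA.
have e3 : \sum_j (u `^ q * t j `^ (- (q - 1)))
    = u `^ q * \sum_j t j `^ (- (q - 1)) by rewrite mulr_sumr.
rewrite e1 e2 e3.
set S1 := \sum_j (t j)^-1 in J1 *; set S2 := \sum_j t j `^ _ in J2 *.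
have -> : m' * (1 + lam * (p * (u - u') / m')
    + c * (a * (p * (u - u') / m') ^+ 2 + D * (p * u / m') `^ q))
    = m' + lam * (p * (u - u')) + c * a * p ^+ 2 * ((u - u') ^+ 2 * m'^-1)
      + c * D * (m' * (p * u / m') `^ q).
  by field; lra.
rewrite yE mE.
have k1 : (u - u') ^+ 2 * m'^-1 <= (u - u') ^+ 2 * (p * S1).
  by rewrite ler_wpM2l ?sqr_ge0.
have ca0 : 0 <= c * a * p ^+ 2 by rewrite mulr_ge0 ?sqr_ge0 ?mulr_ge0.
have k1' := ler_wpM2l ca0 k1.
have k2 := ler_wpM2l (mulr_ge0 (powR_ge0 p q) (powR_ge0 u q)) J2.
have k2' := ler_wpM2l (mulr_ge0 c0 D0) k2.
move: k1' k2'; clear; move: (m'^-1) (p `^ q) (u `^ q) (m' `^ _) => z1 z2 z3 z4.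
lra.
Qed.

Section mixture_moment.
Variables (n : nat) (a a' : 'I_n -> nat -> R) (i0 : 'I_n) (lam x : R).
Hypothesis ak : forall j i, (k <= i)%N -> a j i = 0.
Hypothesis a'k : forall j i, (k <= i)%N -> a' j i = 0.
Hypothesis aE : forall j, j != i0 -> a j = a' j.
Hypothesis Ax : forall j, sqdist (a i0) (a' j) / s ^+ 2 <= x.
Hypothesis Bx : forall j, sqdist (a' i0) (a' j) / s ^+ 2 <= x.

Definition gauss_mixture (b : 'I_n -> nat -> R) v : R :=
  n%:R^-1 * \sum_j ratio (b j) v.

Lemma gauss_mixture_gt0 b v : 0 < gauss_mixture b v.
Proof.
have n0 : (0 < n)%N by case: n i0 => [[]|].
rewrite mulr_gt0 ?invr_gt0 ?ltr0n// (bigD1 i0)//=.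
rewrite ltr_pwDl ?gauss_ratio_gt0// sumr_ge0// => j _.
exact/ltW/gauss_ratio_gt0.
Qed.

Lemma gauss_mean_mixture b : (forall j i, (k <= i)%N -> b j i = 0) ->
  gauss_mean (gauss_mixture b) 1.
Proof.
move=> bk; have n0 : (0 < n)%N by case: n i0 => [[]|].
have -> : 1 = n%:R^-1 * \sum_(j < n) 1 :> R.
  by rewrite sumr_const card_ord mulVf// pnatr_eq0 -lt0n.
apply: gauss_meanZ; first by rewrite invr_ge0.
by apply: gauss_mean_sum => j; exact: gauss_mean_ratio (bk j).
Qed.

Lemma mean_le (F : 'I_n -> R) M : (forall j, F j <= M) ->
  n%:R^-1 * \sum_j F j <= M.
Proof.
move=> FM; have n0 : 0 < n%:R :> R by case: n i0 => [[]|m _]; rewrite ?ltr0n.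
rewrite ler_pdivrMl//; apply: le_trans (ler_sum _ (fun j _ => FM j)) _.
by rewrite sumr_const card_ord mulr_natl.
Qed.

(** Both mixtures have mean 1, so integrating [mixture_powR_le] cancels the linear term; 1 plus the
    second-order terms is then bounded through 1 + z <= exp z. *)
Lemma mixture_moment_le : 1 < lam -> 0 < x <= 3 / 2 ->
  n%:R^-1 * (lam * (1 + x^-1)) * expR (3 / 2 * (lam - 1) * x) <= 1 ->
  (gauss_expect s k (fun v => (gauss_mixture a' v
      * (gauss_mixture a v / gauss_mixture a' v) `^ lam)%:E)
   <= (expR (7 / 2 * lam * (lam - 1) * n%:R^-1 ^+ 2 * x))%:E)%E.
Proof.
move=> l1 x01 hp.
have n0 : (0 < n)%N by case: n i0 => [[]|].
have p0 : 0 < n%:R^-1 :> R by rewrite invr_gt0 ltr0n.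
have [b [D [q [b0 D0 q1 H hx]]]] := powR_remainder_split l1 p0 x01 hp.
set p := n%:R^-1 in p0 H hx hp *.
pose c := lam * (lam - 1) / 2.
have c0 : 0 <= c by rewrite /c !mulr_ge0; lra.
pose A j := sqdist (a i0) (a' j) / s ^+ 2.
pose B j := sqdist (a' i0) (a' j) / s ^+ 2.
pose C j := (sqdist (a i0) (a' j) + sqdist (a' i0) (a' j)
   - sqdist (a i0) (a' i0)) / s ^+ 2 / 2.
have sq0 e f : 0 <= sqdist e f / s ^+ 2.
  by rewrite divr_ge0 ?sqr_ge0// sumr_ge0// => i _; rewrite sqr_ge0.
have Mcross j : gauss_mean (fun v => 2 * (ratio (a i0) v * ratio (a' i0) v
    * (ratio (a' j) v)^-1)) (2 * expR (C j)).
  apply: gauss_meanZ => //.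
  under eq_fun do rewrite gauss_ratio_cross.
  rewrite -[X in gauss_mean _ X]mulr1; apply: gauss_meanZ; first exact: expR_ge0.
  by apply: gauss_mean_ratio => i ki; rewrite ak// !a'k//; lra.
have Mpow (e : nat -> R) j q' : (forall i, (k <= i)%N -> e i = 0) ->
    gauss_mean (fun v => ratio e v `^ q' * ratio (a' j) v `^ (- (q' - 1)))
      (expR (q' * (q' - 1) * (sqdist e (a' j) / s ^+ 2) / 2)).
  move=> ek; under eq_fun do rewrite gauss_ratio_powR.
  rewrite -[X in gauss_mean _ X]mulr1; apply: gauss_meanZ; first exact: expR_ge0.
  by apply: gauss_mean_ratio => i ki; rewrite ek// !a'k//; lra.
have Msq (e : nat -> R) j : (forall i, (k <= i)%N -> e i = 0) ->
    gauss_mean (fun v => ratio e v ^+ 2 * (ratio (a' j) v)^-1)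
      (expR (sqdist e (a' j) / s ^+ 2)).
  move=> ek; have := Mpow e j 2 ek.
  rewrite (_ : 2 * (2 - 1) * _ / 2 = sqdist e (a' j) / s ^+ 2); last first.
    by field; rewrite ?sqrf_eq0.
  apply: eq_gauss_mean => v.
  rewrite (powR_mulrn 2 (ltW (gauss_ratio_gt0 _ _ _ _))).
  rewrite (_ : - (2 - 1) = - 1); last lra.
  by rewrite powR_inv1// ltW// gauss_ratio_gt0.
have l0 : 0 <= lam by lra.
have cb0 := mulr_ge0 (mulr_ge0 c0 b0) (sqr_ge0 p).
have cD0 := mulr_ge0 (mulr_ge0 c0 D0) (powR_ge0 p q).
have p0' := ltW p0.
have M1 := gauss_meanD (gauss_meanZ l0 (gauss_mean_mixture a'k))
  (gauss_meanZ cb0 (gauss_meanZ p0' (gauss_mean_sum Mcross))).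
have M2 := gauss_meanD
  (gauss_meanD (gauss_mean_mixture a'k)
     (gauss_meanZ l0 (gauss_mean_mixture ak)))
  (gauss_meanD
    (gauss_meanZ cb0 (gauss_meanZ p0' (gauss_mean_sum
       (fun j => gauss_meanD (Msq _ j (ak i0)) (Msq _ j (a'k i0))))))
    (gauss_meanZ cD0 (gauss_meanZ p0' (gauss_mean_sum
       (fun j => Mpow _ j q (ak i0)))))).
apply: le_trans (gauss_expect_le_mean _ _ M1 M2 _) _.
- by move=> v; rewrite mulr_ge0 ?powR_ge0// ltW// gauss_mixture_gt0.
- move=> d' Y v mv.
  have mm e : measurable_fun setT (fun y => gauss_mixture e (v y)).
    apply: measurable_funM => //; apply: measurable_sum => j.
    exact: measurable_gauss_ratio.
  apply: measurable_funM => //.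
  apply: (measurableT_comp (measurable_powR _)).
  apply: measurable_funM => //.
  rewrite (_ : (fun y => _) = fun y => gauss_mixture a' (v y) `^ (-1)).
    exact: (measurableT_comp (measurable_powR _)).
  by apply/funext => y; rewrite powR_inv1// ltW// gauss_mixture_gt0.
- move=> v; apply: mixture_powR_le => //.
  + by move=> j; exact: gauss_ratio_gt0.
  + exact: gauss_ratio_gt0.
  + exact: gauss_ratio_gt0.
  + rewrite /gauss_mixture -/p -mulrDr; congr (_ * _).
    rewrite (bigD1 i0)//= [in RHS](bigD1 i0)//=.
    rewrite (eq_bigr (fun j => ratio (a' j) v)); first by lra.
    by move=> j ji; rewrite aE.
  + exact: gauss_mixture_gt0.
- rewrite lee_fin; apply: le_trans (expR_ge1Dx _).
  (* 2 C j is A j + B j minus the normalised squared distance between the two versions of the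
     changed component, itself at most x: the condition of [chi2_exponents_le]. *)
  have K2 : p * \sum_j (expR (A j) + expR (B j) - 2 * expR (C j))
      <= 7 / 2 * x.
    apply: mean_le => j; apply: le_trans (chi2_constant_le x01).
    apply: chi2_exponents_le; rewrite /A /B ?sq0 ?Ax ?Bx//.
    have := Ax i0; rewrite /C; lra.
  have KD : p * \sum_j expR (q * (q - 1) * A j / 2)
      <= expR (q * (q - 1) * x / 2).
    apply: mean_le => j; rewrite ler_expR ler_pM2r ?invr_gt0//.
    apply: ler_wpM2l; [by rewrite mulr_ge0; lra|exact: Ax].
  have := ler_wpM2l cb0 K2; have := ler_wpM2l cD0 KD.
  rewrite sumrB -mulr_sumr.
  have := ler_wpM2l c0 hx.
  rewrite -/A -/B -/C.
  have -> : 7 / 2 * lam * (lam - 1) * p ^+ 2 * x = c * (7 * p ^+ 2 * x).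
    by rewrite /c; field.
  rewrite -/(A _).
  set S1 := \sum_j (_ + _); set S2 := \sum_j expR (C j).
  set S3 := \sum_j expR (q * _ * A j / 2).
  move: (expR _) (p `^ q) => E1 E2; clear; lra.
Qed.
End mixture_moment.
End gauss_mean.
End renyi_bound.

(** * Euclidean projection *)

Section projection.
Variable R : realType.

Section dotv_theory.
Variable d : nat.
Implicit Types u v w : 'rV[R]_d.

Lemma dotvC u v : dotv u v = dotv v u.
Proof. by apply: eq_bigr => j _; rewrite mulrC. Qed.

Lemma dotvDl u v w : dotv (u + v) w = dotv u w + dotv v w.
Proof. by rewrite -big_split; apply: eq_bigr => j _; rewrite mxE mulrDl. Qed.

Lemma dotvZl a u w : dotv (a *: u) w = a * dotv u w.
Proof. by rewrite mulr_sumr; apply: eq_bigr => j _; rewrite mxE mulrA. Qed.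

Lemma dotvBl u v w : dotv (u - v) w = dotv u w - dotv v w.
Proof. by rewrite -scaleN1r dotvDl dotvZl mulN1r. Qed.

Lemma dotvv_ge0 u : 0 <= dotv u u.
Proof. by apply: sumr_ge0 => j _; rewrite -expr2 sqr_ge0. Qed.

Lemma dotvBB u v : dotv (u - v) (u - v) = dotv u u - 2 * dotv u v + dotv v v.
Proof.
rewrite dotvBl dotvC dotvBl (dotvC v (u - v)) dotvBl (dotvC v u); ring.
Qed.

Lemma dotv_le_l1 u : dotv u u <= (\sum_j `|u 0 j|) ^+ 2.
Proof.
rewrite expr2 mulr_suml; apply: ler_sum => j _.
apply: le_trans (ler_norm _) _; rewrite normrM; apply: ler_wpM2l => //.
by rewrite (bigD1 j)//= lerDl sumr_ge0.
Qed.

Lemma sqr_coord_le_dotv u j : (u 0 j) ^+ 2 <= dotv u u.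
Proof.
rewrite /dotv (bigD1 j)//= -expr2 lerDl sumr_ge0// => i _.
by rewrite -expr2 sqr_ge0.
Qed.

Lemma norm2_le u v : (norm2 u <= norm2 v) = (dotv u u <= dotv v v).
Proof. by rewrite /norm2 ler_sqrt ?dotvv_ge0. Qed.
End dotv_theory.

Section nonexpansive.
Variables (d : nat) (W : set 'rV[R]_d) (proj : 'rV[R]_d -> 'rV[R]_d).
Hypotheses (cW : dp_convex_set W) (projP : is_projection W proj).

(** Otherwise a move from [proj x] towards [w], inside [W] by convexity, would come closer to
    [x]. *)
Lemma projection_obtuse x w : W w -> dotv (x - proj x) (w - proj x) <= 0.
Proof.
move=> Ww; have [Wp pmin] := projP x.
set P := dotv _ _; rewrite leNgt; apply/negP => P0.
pose N := dotv (w - proj x) (w - proj x).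
have N0 : 0 <= N by exact: dotvv_ge0.
(* This [a] lies in [0, 1] and a N = P - a P < 2 P, so the squared distance changes by - 2 a P + a^2
   N < 0. *)
pose a := P / (P + N).
have a01 : 0 <= a <= 1.
  by rewrite /a divr_ge0 ?addr_ge0 ?(ltW P0)//= ler_pdivrMr; lra.
have := pmin _ (cW Ww Wp a01); rewrite norm2_le.
rewrite (_ : x - (a *: w + (1 - a) *: proj x)
             = (x - proj x) - a *: (w - proj x)); last first.
  by apply/rowP => j; rewrite !mxE; ring.
rewrite (dotvBB (x - proj x)) (dotvC (x - proj x) (a *: _)) !dotvZl.
rewrite (dotvC _ (a *: _)) dotvZl (dotvC _ (x - proj x)) -/P -/N.
have aE : a * (P + N) = P by rewrite /a mulfVK// gt_eqF//; lra.
have a0 : 0 < a by rewrite divr_gt0//; lra.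
nra.
Qed.

(** The two obtuse-angle inequalities add up to |p - q|^2 <= <x - y, p - q>; nonnegativity of |(x -
    y) - (p - q)|^2 does the rest. *)
Lemma projection_nonexpansive x y :
  dotv (proj x - proj y) (proj x - proj y) <= dotv (x - y) (x - y).
Proof.
have [Wx _] := projP x; have [Wy _] := projP y.
have := projection_obtuse x Wy; have := projection_obtuse y Wx.
pose e := (x - y) - (proj x - proj y).
have := dotvv_ge0 e.
rewrite /e dotvBB.
move: (proj x) (proj y) => p q.
rewrite !(dotvBl, dotvC _ (_ - _)) (dotvC y x) (dotvC p x) (dotvC q x)
  (dotvC p y) (dotvC q y) (dotvC q p).
lra.
Qed.
End nonexpansive.

(** Equivalent to measurability into the product sigma-algebra of [d.-tuple R], by
    [coord_measurable_tuple]. *)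
Definition coord_measurable d0 (X : measurableType d0) d
    (V : X -> 'rV[R]_d) : Prop :=
  forall j, measurable_fun setT (fun x => V x 0 j).

Section coord_measurable_theory.
Variables (d0 : measure_display) (X : measurableType d0) (d : nat).
Implicit Types V : X -> 'rV[R]_d.

Lemma coord_measurable_cst (c : 'rV[R]_d) : coord_measurable (fun _ : X => c).
Proof. by move=> j; exact: measurable_cst. Qed.

Lemma coord_measurableD V1 V2 : coord_measurable V1 -> coord_measurable V2 ->
  coord_measurable (fun x => V1 x + V2 x).
Proof.
move=> m1 m2 j; under eq_fun do rewrite mxE; exact: measurable_funD.
Qed.

Lemma coord_measurableZ a V : coord_measurable V ->
  coord_measurable (fun x => a *: V x).
Proof.
move=> m1 j; under eq_fun do rewrite mxE; exact: measurable_funM.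
Qed.

Lemma coord_measurableB V1 V2 : coord_measurable V1 -> coord_measurable V2 ->
  coord_measurable (fun x => V1 x - V2 x).
Proof.
move=> m1 m2; apply: coord_measurableD => //.
by under eq_fun do rewrite -scaleN1r; exact: coord_measurableZ.
Qed.

Lemma coord_measurable_tuple V :
  coord_measurable V <-> measurable_fun setT (fun x => tuple_of_row (V x)).
Proof.
split=> [mV|/measurable_fun_tnthP mV j].
  apply/measurable_fun_tnthP => j; rewrite (_ : _ \o _ = fun x => V x 0 j)//.
  by apply/funext => x /=; rewrite tnth_mktuple.
have := mV j; rewrite (_ : _ \o _ = fun x => V x 0 j)//.
by apply/funext => x /=; rewrite tnth_mktuple.
Qed.

(* [h] is the infimum over rational [q] of [h q + l1-distance to q]. *)
Lemma measurable_l1_lipschitz (h : 'rV[R]_d -> R) V :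
  (forall x y, `|h x - h y| <= \sum_j `|x 0 j - y 0 j|) ->
  coord_measurable V -> measurable_fun setT (h \o V).
Proof.
move=> hL mV mD; apply: (measurability _ (RGenInftyO.measurableE R)) => //.
move=> _ [_ [a ->] <-]; rewrite setTI.
pose row (q : d.-tuple rat) : 'rV[R]_d := \row_j ratr (tnth q j).
pose dst q x := \sum_j `|V x 0 j - row q 0 j|.
rewrite (_ : _ @^-1` _ =
  \bigcup_(q : d.-tuple rat) [set x | h (row q) + dst q x < a]).
  apply: countable_bigcupT_measurable; first exact: countableP.
  move=> q; have mq : measurable_fun setT (fun x => h (row q) + dst q x).
    apply: measurable_funD => //; apply: measurable_sum => j.
    by apply: measurableT_comp => //; exact: measurable_funB.
  rewrite (_ : [set x | _] = setT `&` (fun x => h (row q) + dst q x) @^-1`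
    `]-oo, a[%classic); first by apply: mq => //; exact: measurable_itv.
  by rewrite setTI; apply/seteqP; split=> x /=; rewrite in_itv.
apply/seteqP; split=> x /=.
  rewrite in_itv/= => ha.
  (* The gap a - h (V x) must cover both the change of [h] and the distance term, each at most d e;
     the divisor keeps d e below half the gap, also for d = 0. *)
  pose e := (a - h (V x)) / (2 * d.+1%:R).
  have e0 : 0 < e by rewrite divr_gt0 ?mulr_gt0 ?ltr0n// subr_gt0.
  have /choice[q qP] (j : 'I_d) : exists q : rat, `|V x 0 j - ratr q| <= e.
    have [|q] := @rat_in_itvoo R (V x 0 j - e) (V x 0 j + e); first lra.
    rewrite in_itv/= => /andP[q1 q2]; exists q.
    by rewrite ler_distlC; lra.
  pose Q := [tuple q j | j < d].
  have dQ : dst Q x <= d%:R * e.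
    rewrite mulr_natl -[X in e *+ X]card_ord -sumr_const.
    by apply: ler_sum => j _; rewrite mxE tnth_mktuple.
  exists Q => //=.
  have := hL (row Q) (V x).
  under eq_bigr do rewrite distrC.
  rewrite -/(dst Q x) => /ler_normlW h1.
  have de : d%:R * e < (a - h (V x)) / 2.
    rewrite (_ : (a - h (V x)) / 2 = d.+1%:R * e); last first.
      by rewrite /e; field; rewrite ?pnatr_eq0.
    by rewrite ltr_pM2r// ltr_nat.
  lra.
move=> [q _ /= hq]; rewrite in_itv/=.
have := hL (V x) (row q); rewrite -/(dst q x) ler_norml => /andP[_]; lra.
Qed.

End coord_measurable_theory.

(** Nonexpansiveness makes each coordinate of [proj] 1-Lipschitz for the Euclidean norm, hence for
    the l1 norm. *)
Lemma coord_measurable_projection d0 (X : measurableType d0) d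
    (W : set 'rV[R]_d) (proj : 'rV[R]_d -> 'rV[R]_d) (V : X -> 'rV[R]_d) :
  dp_convex_set W -> is_projection W proj -> coord_measurable V ->
  coord_measurable (proj \o V).
Proof.
move=> cW projP mV j.
apply: (@measurable_l1_lipschitz _ _ _ (fun u => proj u 0 j)) => // x y.
rewrite -(@ler_pXn2r _ 2)// ?nnegrE ?sumr_ge0//.
rewrite real_normK ?num_real//.
have -> : proj x 0 j - proj y 0 j = (proj x - proj y) 0 j by rewrite !mxE.
apply: le_trans (sqr_coord_le_dotv _ _) _.
apply: le_trans (projection_nonexpansive cW projP x y) _.
apply: le_trans (dotv_le_l1 _) _.
by under eq_bigr do rewrite !mxE.
Qed.
End projection.

(** * Output law and privacy of DP-SGD *)

Section trajectory.
Variables (R : realType) (Z : Type) (d n : nat).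
Variables (proj : 'rV[R]_d -> 'rV[R]_d) (g : 'rV[R]_d -> Z -> 'rV[R]_d).
Variables (eta : nat -> R) (s c : R) (E : set (d.-tuple R)).
Hypothesis s0 : s != 0.
Hypothesis mE : measurable E.
Hypothesis mproj : forall d0 (X : measurableType d0) (V : X -> 'rV[R]_d),
  coord_measurable V -> coord_measurable (proj \o V).
Hypothesis mg : forall z d0 (X : measurableType d0) (V : X -> 'rV[R]_d),
  coord_measurable V -> coord_measurable (fun x => g (V x) z).

Implicit Types (w acc : 'rV[R]_d) (v : nat -> R) (S : 'I_n -> Z).

Definition row_noise v : 'rV[R]_d := \row_j v j.

Definition sgd_step t w u : 'rV[R]_d := proj (w - eta t *: u).

Definition traj_sum zs t w v : 'rV[R]_d :=
  \sum_(w' <- dpsgd_traj proj g eta w t (zip zs (noise_of d (size zs) v))) w'.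

(** The first iteration consumes the first [d] noise coordinates; the rest of the trajectory reads
    the sequence shifted by [d]. *)
Lemma traj_sum_cons z zs t w v : traj_sum (z :: zs) t w v =
  w + traj_sum zs t.+1 (sgd_step t w (g w z + row_noise v))
        (fun i => v (d + i)%N).
Proof.
rewrite /traj_sum /= big_cons; congr (_ + _).
rewrite (_ : \row_j v (0 * d + j)%N = row_noise v); last first.
  by apply/rowP => j; rewrite !mxE mul0n add0n.
rewrite (_ : [seq _ | t0 <- iota 1 (size zs)]
             = noise_of d (size zs) (fun i => v (d + i)%N))//.
rewrite /noise_of (iotaDl 1 0) -map_comp; apply: eq_map => i /=.
by apply/rowP => j; rewrite !mxE mulSn addnA.
Qed.

Lemma coord_measurable_row_noise d0 (X : measurableType d0) (v : X -> nat -> R) :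
  (forall i, measurable_fun setT (v ^~ i)) ->
  coord_measurable (fun x => row_noise (v x)).
Proof. by move=> mv j; under eq_fun do rewrite mxE; exact: mv. Qed.

Lemma coord_measurable_step d0 (X : measurableType d0) t
    (w u : X -> 'rV[R]_d) : coord_measurable w -> coord_measurable u ->
  coord_measurable (fun x => sgd_step t (w x) (u x)).
Proof.
move=> mw mu; apply: mproj; apply: coord_measurableB => //.
exact: coord_measurableZ.
Qed.

Lemma coord_measurable_traj_sum d0 (X : measurableType d0) zs t
    (w : X -> 'rV[R]_d) (v : X -> nat -> R) : coord_measurable w ->
  (forall i, measurable_fun setT (v ^~ i)) ->
  coord_measurable (fun x => traj_sum zs t (w x) (v x)).
Proof.
elim: zs t w v => [|z zs IH] t w v mw mv.
  under eq_fun do rewrite /traj_sum big_nil; exact: coord_measurable_cst.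
under eq_fun do rewrite traj_sum_cons.
apply: coord_measurableD => //; apply: IH; last by move=> i; exact: mv.
apply: coord_measurable_step => //.
by apply: coord_measurableD; [exact: mg|exact: coord_measurable_row_noise].
Qed.

(** The averaged output depends on the past only through [w] and the running sum [acc]; [c] is the
    final factor 1/T. *)
Definition hit zs t w acc v : \bar R :=
  (\1_E (tuple_of_row (c *: (acc + traj_sum zs t w v))))%:E.

Lemma hit_ge0 zs t w acc v : (0 <= hit zs t w acc v)%E.
Proof. by rewrite lee_fin. Qed.

Lemma noise_measurable_hit d0 (X : measurableType d0) zs t
    (w acc : X -> 'rV[R]_d) : coord_measurable w -> coord_measurable acc ->
  noise_measurable (fun x => hit zs t (w x) (acc x)).
Proof.
move=> mw ma d' Y phi v mphi mv; apply/measurable_EFinP.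
apply: (measurableT_comp (measurable_indic mE)).
apply/coord_measurable_tuple; apply: coord_measurableZ.
have mphi' (V : X -> 'rV[R]_d) : coord_measurable V ->
    coord_measurable (fun y => V (phi y)).
  by move=> mV j; exact: (measurableT_comp (mV j)).
apply: coord_measurableD; first exact: mphi'.
by apply: coord_measurable_traj_sum => //; exact: mphi'.
Qed.

(* Probability that the output lands in [E] when [k] steps remain, the current
   iterate being [w] and the sum of the previous ones being [acc]. *)
Definition hit_prob S k t w acc : \bar R :=
  (((n ^ k)%:R^-1)%:E * \sum_(idx : k.-tuple 'I_n)
     gauss_expect s (k * d) (hit [seq S i | i <- idx] t w acc))%E.

Lemma hit_prob_ge0 S k t w acc : (0 <= hit_prob S k t w acc)%E.
Proof.
rewrite mule_ge0 ?lee_fin ?invr_ge0// sume_ge0// => i _.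
by apply: gauss_expect_ge0 => v; exact: hit_ge0.
Qed.

Lemma measurable_gauss_hit zs k t d0 (X : measurableType d0)
    (w acc : X -> 'rV[R]_d) : coord_measurable w -> coord_measurable acc ->
  measurable_fun setT (fun x => gauss_expect s k (hit zs t (w x) (acc x))).
Proof.
move=> mw ma.
apply: (@measurable_gauss_expect R s k _ X
  (fun x => hit zs t (w x) (acc x))) => //; first by move=> *; exact: hit_ge0.
exact: noise_measurable_hit.
Qed.

Lemma measurable_hit_prob S k t d0 (X : measurableType d0)
    (w acc : X -> 'rV[R]_d) : coord_measurable w -> coord_measurable acc ->
  measurable_fun setT (fun x => hit_prob S k t (w x) (acc x)).
Proof.
move=> mw ma; apply: emeasurable_funM => //.
apply: emeasurable_sum => idx; exact: measurable_gauss_hit.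
Qed.

Lemma big_tuple_cons k (F : k.+1.-tuple 'I_n -> \bar R) :
  (\sum_(idx : k.+1.-tuple 'I_n) F idx =
   \sum_(i < n) \sum_(idx : k.-tuple 'I_n) F [tuple of i :: idx])%E.
Proof.
rewrite pair_big /=.
rewrite (reindex (fun p : 'I_n * k.-tuple 'I_n => [tuple of p.1 :: p.2]))//=.
exists (fun t : k.+1.-tuple 'I_n => (thead t, [tuple of behead t])).
  by move=> [i t] _ /=; rewrite theadE; congr (_, _); apply: val_inj.
by move=> t _ /=; rewrite -tuple_eta.
Qed.

(** Markov property at the first step: the head of the index tuple and the first noise block are
    split off. *)
Lemma hit_probS S k t w acc : hit_prob S k.+1 t w acc =
  ((n%:R^-1)%:E * \sum_(i < n) gauss_expect s d (fun b =>
     hit_prob S k t.+1 (sgd_step t w (g w (S i) + row_noise b)) (acc + w)%R))%E.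
Proof.
rewrite /hit_prob big_tuple_cons expnS natrM invfM EFinM -muleA.
congr (_ * _)%E.
rewrite ge0_sume_distrr; last first.
  move=> i _; apply: sume_ge0 => idx _.
  by apply: gauss_expect_ge0 => v; exact: hit_ge0.
apply: eq_bigr => i _.
pose W b := sgd_step t w (g w (S i) + row_noise b).
have mW d' (Y : measurableType d') (v : Y -> nat -> R) :
    (forall i, measurable_fun setT (v ^~ i)) ->
    coord_measurable (fun y => W (v y)).
  move=> mv; apply: coord_measurable_step; first exact: coord_measurable_cst.
  apply: coord_measurableD; first exact: coord_measurable_cst.
  exact: coord_measurable_row_noise.
have mG (idx : k.-tuple 'I_n) : noise_measurable (fun _ : unit => fun b =>
    gauss_expect s (k * d) (hit [seq S i | i <- idx] t.+1 (W b) (acc + w))).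
  move=> d' Y phi v _ mv; apply: measurable_gauss_hit; first exact: mW.
  exact: coord_measurable_cst.
have G0 (idx : k.-tuple 'I_n) b : (0 <= gauss_expect s (k * d)
    (hit [seq S i | i <- idx] t.+1 (W b) (acc + w)))%E.
  by apply: gauss_expect_ge0 => v; exact: hit_ge0.
rewrite gauss_expectZl ?invr_ge0//; last 2 first.
- by move=> b; apply: sume_ge0 => idx _; exact: G0.
- apply: noise_measurable_sum => idx; exact: mG.
congr (_ * _)%E; rewrite gauss_expect_sum//; apply: eq_bigr => idx _.
rewrite mulSn gauss_expectD_dim//; apply: eq_gauss_expect => b.
apply: eq_gauss_expect => v; rewrite /hit /= traj_sum_cons addrA.
congr ((\1_E (tuple_of_row (c *: (_ + _))))%:E).
pose v' i := if (i < d)%N then b i else v (i - d)%N.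
rewrite -/v' (_ : row_noise v' = row_noise b); last first.
  by apply/rowP => j; rewrite !mxE /v' ltn_ord.
congr traj_sum; apply/funext => l.
by rewrite /v' ltnNge leq_addr /= addKn.
Qed.

(** Zero padding past [d] makes the gradient an admissible shift in [gauss_expect_shift]. *)
Definition grad_coord w z : nat -> R :=
  fun l => oapp (g w z 0) 0 (insub l : option 'I_d).

Lemma grad_coord_out w z l : (d <= l)%N -> grad_coord w z l = 0.
Proof. by move=> dl; rewrite /grad_coord insubN// -leqNgt. Qed.

Lemma grad_coordE w z (j : 'I_d) : grad_coord w z j = g w z 0 j.
Proof. by rewrite /grad_coord valK. Qed.

Lemma row_noise_grad w z b :
  row_noise (fun l => grad_coord w z l + b l) = g w z + row_noise b.
Proof. by apply/rowP => j; rewrite !mxE grad_coordE. Qed.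

Lemma sqdist_grad w z w' z' :
  sqdist d (grad_coord w z) (grad_coord w' z')
  = dotv (g w z - g w' z') (g w z - g w' z').
Proof. by apply: eq_bigr => j _; rewrite !grad_coordE !mxE expr2. Qed.

Definition grad_mixture S w : (nat -> R) -> R :=
  gauss_mixture s d (fun i => grad_coord w (S i)).

(** With [t.-1], the instance at [t.+1] matches later uses by conversion. *)
Lemma noise_measurable_hit_prob S k t w acc :
  noise_measurable (fun _ : unit => fun b =>
    hit_prob S k t (sgd_step t.-1 w (row_noise b)) acc).
Proof.
move=> d' Y phi v _ mv; apply: measurable_hit_prob.
  apply: coord_measurable_step; first exact: coord_measurable_cst.
  exact: coord_measurable_row_noise.
exact: coord_measurable_cst.
Qed.

(** The gradient is absorbed into the noise by a change of measure. The next state then depends on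
    [b] alone, and within this step the data enter only through the weight, so two datasets are
    compared under one integral. *)
Lemma hit_prob_mixture S k t w acc : hit_prob S k.+1 t w acc =
  gauss_expect s d (fun b => (grad_mixture S w b)%:E *
    hit_prob S k t.+1 (sgd_step t w (row_noise b)) (acc + w)%R)%E.
Proof.
pose Psi b := hit_prob S k t.+1 (sgd_step t w (row_noise b)) (acc + w).
have Psi0 b : (0 <= Psi b)%E by exact: hit_prob_ge0.
have mPsi : noise_measurable (fun _ : unit => Psi).
  exact: noise_measurable_hit_prob.
pose ratio i b := gauss_ratio s d (grad_coord w (S i)) b.
have r0 i b : (0 <= (ratio i b)%:E * Psi b)%E.
  by rewrite mule_ge0// lee_fin ltW// gauss_ratio_gt0.
have mr i : noise_measurable (fun _ : unit => fun b => (ratio i b)%:E * Psi b)%E.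
  exact: noise_measurable_ratioM.
rewrite hit_probS (eq_bigr (fun i => gauss_expect s d
    (fun b => (ratio i b)%:E * Psi b)%E)); last first.
  move=> i _.
  rewrite -(gauss_expect_shift s0 (@grad_coord_out w (S i)) Psi0 mPsi).
  by apply: eq_gauss_expect => b; rewrite /Psi row_noise_grad.
rewrite -gauss_expect_sum// -gauss_expectZl ?invr_ge0//; last 2 first.
- by move=> b; apply: sume_ge0.
- exact: noise_measurable_sum.
apply: eq_gauss_expect => b.
rewrite -ge0_sume_distrl; last first.
  by move=> i _; rewrite lee_fin ltW// gauss_ratio_gt0.
by rewrite muleA sumEFin -EFinM.
Qed.

Lemma hit_prob0 S t w acc :
  hit_prob S 0 t w acc = (\1_E (tuple_of_row (c *: acc)))%:E.
Proof.
rewrite /hit_prob expn0 invr1 mul1e (bigD1 [tuple])//= big1; last first.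
  by move=> i /negP[]; apply/eqP; exact: tuple0.
by rewrite adde0 /hit /traj_sum /= big_nil addr0.
Qed.

(** * Composition over the iterations *)

Section privacy.
Variables (S S' : 'I_n -> Z) (i0 : 'I_n) (lam eps K : R).
Hypotheses (l1 : 1 < lam) (K0 : 0 <= K).
Hypothesis momentK : forall w, (gauss_expect s d (fun b => (grad_mixture S' w b
  * (grad_mixture S w b / grad_mixture S' w b) `^ lam)%:E) <= K%:E)%E.

(* Carrying the likelihood ratio [r] accumulated so far turns adaptive
   composition of the moment bounds into an induction on the steps left. *)
Lemma hit_prob_tradeoff k t w acc (r : R) : 0 < r ->
  (r%:E * hit_prob S k t w acc <= (expR eps)%:E * hit_prob S' k t w acc
     + (expR (- (eps * (lam - 1))) * r `^ lam * K ^+ k)%:E)%E.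
Proof.
elim: k t w acc r => [|k IH] t w acc r r0.
  rewrite !hit_prob0 -!EFinM -EFinD lee_fin expr0 mulr1.
  have cr0 : 0 <= expR (- (eps * (lam - 1))) * r `^ lam.
    by rewrite mulr_ge0 ?expR_ge0 ?powR_ge0.
  rewrite indicE; case: (_ \in _); rewrite ?mulr0 ?add0r// !mulr1.
  (* If r > e^eps then r^(lam - 1) >= e^(eps (lam - 1)), so the second term alone dominates r. *)
  have [re|re] := leP r (expR eps); first by rewrite ler_wpDr.
  rewrite ler_wpDl ?expR_ge0// /powR gt_eqF// -expRD.
  rewrite -[leLHS](lnK r0) ler_expR.
  have : eps < ln r by rewrite -(expRK eps) ltr_ln ?posrE ?expR_gt0.
  move=> er.
  have : 0 <= (lam - 1) * (ln r - eps) by rewrite mulr_ge0 ?subr_ge0 ?ltW.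
  lra.
set C := expR (- (eps * (lam - 1))) in IH *.
have C0 : 0 <= C by exact: expR_ge0.
rewrite !hit_prob_mixture.
pose Psi Q b := hit_prob Q k t.+1 (sgd_step t w (row_noise b)) (acc + w).
have Psi0 Q b : (0 <= Psi Q b)%E by exact: hit_prob_ge0.
have mPsi Q : noise_measurable (fun _ : unit => Psi Q).
  exact: noise_measurable_hit_prob.
have m0 Q b : 0 < grad_mixture Q w b by exact: gauss_mixture_gt0.
have mm Q : noise_measurableR (grad_mixture Q w).
  move=> d' Y v mv; apply: measurable_funM => //; apply: measurable_sum => j.
  exact: measurable_gauss_ratio.
have mmPsi Q : noise_measurable (fun _ : unit => fun b =>
    (grad_mixture Q w b)%:E * Psi Q b)%E.
  move=> d' Y phi v mphi mv; apply: emeasurable_funM.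
    by apply/measurable_EFinP; exact: mm.
  exact: (mPsi Q _ _ phi).
have mPsi0 Q b : (0 <= (grad_mixture Q w b)%:E * Psi Q b)%E.
  by rewrite mule_ge0// lee_fin ltW.
pose M b := grad_mixture S' w b
  * (grad_mixture S w b / grad_mixture S' w b) `^ lam.
have M0 b : 0 <= M b by rewrite mulr_ge0 ?powR_ge0// ltW.
have mM : noise_measurableR M.
  move=> d' Y v mv; apply: measurable_funM; first exact: mm.
  apply: (measurableT_comp (measurable_powR _)).
  apply: measurable_funM; first exact: mm.
  rewrite (_ : (fun y => _) = fun y => grad_mixture S' w (v y) `^ (-1)).
    by apply: (measurableT_comp (measurable_powR _)); exact: mm.
  by apply/funext => y; rewrite powR_inv1// ltW.
have mME : noise_measurable (fun _ : unit => fun b => (M b)%:E).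
  exact: noise_measurable_EFin.
pose B := C * r `^ lam * K ^+ k.
have B0 : 0 <= B by rewrite /B !mulr_ge0 ?powR_ge0 ?exprn_ge0.
rewrite -gauss_expectZl ?(ltW r0)//.
have rhs b : ((expR eps)%:E * ((grad_mixture S' w b)%:E * Psi S' b)
    + B%:E * (M b)%:E >= 0)%E.
  by rewrite adde_ge0// mule_ge0// lee_fin ?expR_ge0.
apply: (@le_trans _ _ (gauss_expect s d (fun b =>
  (expR eps)%:E * ((grad_mixture S' w b)%:E * Psi S' b) + B%:E * (M b)%:E)%E)).
  apply: le_gauss_expect => //.
  - by move=> b; rewrite mule_ge0// lee_fin ltW.
  - move=> d' Y phi v mphi mv; apply: emeasurable_funM => //.
    exact: (mmPsi S _ _ phi).
  - move=> d' Y phi v mphi mv; apply: emeasurable_funD; apply: emeasurable_funM => //.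
      exact: (mmPsi S' _ _ phi).
    exact: (mME _ _ phi).
  (* The likelihood ratio of this step is [rho]; the induction hypothesis is used at [r * rho] and
     weighted by the mixture of [S'], which produces [M b]. *)
  move=> b; pose rho := grad_mixture S w b / grad_mixture S' w b.
  have rho0 : 0 < rho by rewrite divr_gt0.
  have := IH t.+1 (sgd_step t w (row_noise b)) (acc + w) _ (mulr_gt0 r0 rho0).
  rewrite -!/(Psi _ b) => /(lee_wpmul2l _) h.
  have {h} := h (grad_mixture S' w b)%:E.
  rewrite lee_fin => /(_ (ltW (m0 _ _))).
  have -> : (r%:E * ((grad_mixture S w b)%:E * Psi S b) =
      (grad_mixture S' w b)%:E * ((r * rho)%:E * Psi S b))%E.
    move: (Psi S b) => P.
    rewrite !muleA -!EFinM; congr (_%:E * _)%E; rewrite /rho.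
    by field; rewrite gt_eqF ?m0.
  move=> /le_trans; apply.
  rewrite ge0_muleDr ?lee_fin; last 2 first.
  - by rewrite mule_ge0// lee_fin expR_ge0.
  - by rewrite !mulr_ge0 ?powR_ge0 ?exprn_ge0.
  rewrite le_eqVlt; apply/orP; left; apply/eqP; congr (_ + _)%E.
    by rewrite muleCA.
  rewrite -!EFinM; congr (_%:E).
  rewrite /B /M -/rho powRM ?(ltW r0) ?(ltW rho0)//; ring.
rewrite gauss_expectD//; last 4 first.
- by move=> b; rewrite mule_ge0// lee_fin expR_ge0.
- by move=> b; rewrite mule_ge0// lee_fin.
- move=> d' Y phi v mphi mv; apply: emeasurable_funM => //.
  exact: (mmPsi S' _ _ phi).
- move=> d' Y phi v mphi mv; apply: emeasurable_funM => //.
  exact: (mME _ _ phi).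
rewrite !gauss_expectZl ?expR_ge0//.
rewrite leeD2l// exprSr mulrA -/B (EFinM B K).
by apply: lee_wpmul2l; [rewrite lee_fin|exact: momentK].
Qed.
End privacy.

End trajectory.

(** * Privacy guarantee: final constants *)

Unset Implicit Arguments. Set Strict Implicit.

Theorem theorem1 (R : realType) (Z : Type) (d n T : nat)
  (W : set 'rV[R]_d) (f : 'rV[R]_d -> Z -> R) (g : 'rV[R]_d -> Z -> 'rV[R]_d)
  (proj : 'rV[R]_d -> 'rV[R]_d) (eta : nat -> R)
  (G eps delta beta : R) :
  (0 < n)%N ->
  dp_convex_set W ->
  (forall z, dp_convex_fun W (f ^~ z)) ->
  (forall z, dp_lipschitz W G (f ^~ z)) ->
  is_subgradient W f g ->
  (forall w z, norm2 (g w z) <= G) ->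
  (forall z, measurable_fun [set: d.-tuple R]
               (fun t => tuple_of_row (g (row_of_tuple t) z))) ->
  is_projection W proj ->
  0 < beta < 1 -> 0 < eps -> 0 < delta < 1 ->
  let sigma2 := dpsgd_sigma2 G eps delta beta n T in
  let lambda := ln (1 / delta) / ((1 - beta) * eps) + 1 in
  268 / 100 * G ^+ 2 <= sigma2 ->
  lambda - 1 <= sigma2 / (6 * G ^+ 2)
                * ln (n%:R / (lambda * (1 + sigma2 / (4 * G ^+ 2)))) ->
  forall (S S' : 'I_n -> Z), neighbouring S S' ->
  forall E : set (d.-tuple R), measurable E ->
  (dpsgd_prob T proj g eta sigma2 S E
     <= (expR eps)%:E * dpsgd_prob T proj g eta sigma2 S' E + delta%:E)%E.
Proof.
move=> n0 cW _ _ _ gG mg projP /andP[b0 b1] e0 /andP[d0 d1] sigma2 lambda.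
move=> hs hl S S' [i0 [_ SS']] E mE.
have G0 : 0 <= G by apply: le_trans (gG 0 (S i0)); rewrite /norm2 sqrtr_ge0.
have n0' : 0 < n%:R :> R by rewrite ltr0n.
have ld : 0 < ln (1 / delta).
  by rewrite ln_gt0// div1r invf_gt1.
have be0 : 0 < (1 - beta) * eps by rewrite mulr_gt0// subr_gt0.
have l1 : 1 < lambda by rewrite /lambda ltrDr divr_gt0.
have lE : (lambda - 1) * ((1 - beta) * eps) = ln (1 / delta).
  by rewrite /lambda addrK mulfVK// gt_eqF.
have sigmaE : sigma2 * (beta * n%:R ^+ 2 * eps) = 14 * G ^+ 2 * T%:R * lambda.
  by rewrite /sigma2 /dpsgd_sigma2 -/lambda; field; rewrite !gt_eqF.
clearbody sigma2 lambda.
(* If G = 0, division by zero gives 0 and the second hypothesis reads lambda - 1 <= 0, against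
   lambda > 1. *)
have Gn0 : G != 0.
  apply/eqP => G00; move: hl.
  by rewrite G00 expr0n/= mulr0 invr0 mulr0 mul0r; lra.
have Gp : 0 < G by rewrite lt_neqAle eq_sym Gn0.
have G2 : 0 < G ^+ 2 by rewrite exprn_gt0.
have s2 : 0 < sigma2 by apply: lt_le_trans hs; rewrite mulr_gt0 ?divr_gt0 ?ltr0n.
pose s := Num.sqrt sigma2.
have s0 : s != 0 by rewrite /s gt_eqF// sqrtr_gt0.
have sE : s ^+ 2 = sigma2 by rewrite sqr_sqrtr// ltW.
pose x := 4 * G ^+ 2 / sigma2.
have x0 : 0 < x by rewrite divr_gt0// mulr_gt0.
(* This is where 2.68 enters: 4 / 2.68 < 3/2. *)
have x32 : x <= 3 / 2 by rewrite /x ler_pdivrMr//; lra.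
have xE : sigma2 / (4 * G ^+ 2) = x^-1 by rewrite invf_div.
have xE' : sigma2 / (6 * G ^+ 2) = 2 / 3 * x^-1.
  by rewrite -xE; field; rewrite gt_eqF.
rewrite xE xE' in hl.
have lx0 : 0 < lambda * (1 + x^-1).
  by rewrite mulr_gt0 ?addr_gt0 ?invr_gt0//; lra.
(* The bound on lambda - 1, multiplied by 3/2 x and exponentiated. *)
have hp : n%:R^-1 * (lambda * (1 + x^-1)) * expR (3 / 2 * (lambda - 1) * x) <= 1.
  have h1 : 3 / 2 * (lambda - 1) * x <= ln (n%:R / (lambda * (1 + x^-1))).
    have := ler_wpM2l (ltW x0) hl.
    set L := ln _.
    have -> : x * (2 / 3 / x * L) = 2 / 3 * L by field; rewrite gt_eqF.
    lra.
  have : expR (3 / 2 * (lambda - 1) * x) <= n%:R / (lambda * (1 + x^-1)).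
    by rewrite -[leRHS]lnK ?posrE ?divr_gt0// ler_expR.
  by rewrite ler_pdivlMr// -[n%:R^-1 * _ * _]mulrA ler_pdivrMl// mulr1 mulrC.
pose K := expR (7 / 2 * lambda * (lambda - 1) * n%:R^-1 ^+ 2 * x).
have mprojP d0' (X : measurableType d0') (V : X -> 'rV[R]_d) :
    coord_measurable V -> coord_measurable (proj \o V).
  by move=> mV; apply: (coord_measurable_projection cW).
have mgP z d0' (X : measurableType d0') (V : X -> 'rV[R]_d) :
    coord_measurable V -> coord_measurable (fun y => g (V y) z).
  move=> /coord_measurable_tuple mV; apply/coord_measurable_tuple.
  have := measurableT_comp (mg z) mV.
  rewrite (_ : _ \o _ = fun y => tuple_of_row (g (V y) z))//.
  apply/funext => y /=; congr (tuple_of_row (g _ z)).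
  by apply/rowP => j; rewrite mxE tnth_mktuple.
have gg w z w' z' : dotv (g w z - g w' z') (g w z - g w' z') / s ^+ 2 <= x.
  have gz u t : dotv (g u t) (g u t) <= G ^+ 2.
    have := gG u t; rewrite -(@ler_pXn2r _ 2)// ?nnegrE ?sqrtr_ge0//.
    by rewrite /norm2 sqr_sqrtr ?dotvv_ge0.
  rewrite sE /x ler_pM2r ?invr_gt0//.
  (* Parallelogram law: |u - v|^2 <= 2 |u|^2 + 2 |v|^2 <= 4 G^2. *)
  have := dotvv_ge0 (g w z - (- g w' z')).
  have := gz w z; have := gz w' z'.
  rewrite !dotvBB (dotvC _ (- _)) -(scaleN1r (g w' z')) !dotvZl.
  rewrite (dotvC _ (_ *: _)) dotvZl (dotvC (g w' z')); lra.
have mom w : (gauss_expect s d (fun b => (grad_mixture g s S' w b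
   * (grad_mixture g s S w b / grad_mixture g s S' w b) `^ lambda)%:E) <= K%:E)%E.
  apply: (@mixture_moment_le _ _ s0 d n _ _ i0 lambda x) => //.
  - by move=> j i; exact: grad_coord_out.
  - by move=> j i; exact: grad_coord_out.
  - by move=> j ji; rewrite SS'.
  - by move=> j; rewrite sqdist_grad.
  - by move=> j; rewrite sqdist_grad.
  - by rewrite x0.
have probE Q : dpsgd_prob T proj g eta sigma2 Q E
    = hit_prob proj g eta s T%:R^-1 E Q T 0 0 0.
  rewrite /dpsgd_prob /hit_prob; congr (_ * _)%E; apply: eq_bigr => idx _.
  apply: eq_gauss_expect => v; rewrite /hit /dpsgd_output add0r /traj_sum.
  by rewrite size_map size_tuple.
have := hit_prob_tradeoff eta T%:R^-1 s0 mE mprojP mgP i0 eps l1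
  (expR_ge0 _) mom T 0 0 0 ltr01.
rewrite mul1e powR1 mulr1 -!probE => /le_trans; apply.
rewrite leeD2l// lee_fin /K -expRM_natl -expRD.
rewrite -[leRHS]lnK ?posrE// ler_expR.
have -> : ln delta = - ln (1 / delta) by rewrite div1r lnV ?posrE// opprK.
(* The noise variance is calibrated so that the T moments accumulate to (lambda - 1) beta eps. The
   exponent left is - (lambda - 1) (1 - beta) eps = ln delta. *)
have -> : T%:R * (7 / 2 * lambda * (lambda - 1) * n%:R^-1 ^+ 2 * x)
    = (lambda - 1) * (beta * eps).
  transitivity ((14 * G ^+ 2 * T%:R * lambda) * (lambda - 1)
    / (n%:R ^+ 2 * sigma2)); first by rewrite /x; field; rewrite !gt_eqF.
  by rewrite -sigmaE; field; rewrite !gt_eqF.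
by rewrite -lE; lra.
Qed.
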